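(* Let $p,q\ge1$, let $G=P_p*K_q^c$ be the fan graph, and let $S=K[x_v,y_v : v\in V(G)]$. Then $$\operatorname{Hilb}_{S/J_G}(t)=\frac{(1+t)^{p-1}}{(1-t)^{p+1}}+\frac{1}{(1-t)^{2q}}+\frac{(p+q-1)t+1}{(1-t)^{p+q+1}}-\frac{(p-1)t+1}{(1-t)^{p+1}}-\frac{(q-1)t+1}{(1-t)^{q+1}}.$$ In particular, $\dim(S/J_G)=\max\{2q,p+q+1\}$ and $$e(S/J_G)=\begin{cases}1 & \text{if } p+1<q,\\ p+q+1 & \text{if } p+1=q,\\ p+q & \text{if } p+1>q.\end{cases}$$
   Context: $K$ is a field and $S$ is standard graded. $P_p$ is the path on $p$ vertices and $K_q^c$ is the graph of $q$ isolated vertices. The join $H*H'$ of graphs $H,H'$ on disjoint vertex sets is the graph on $V(H)\sqcup V(H')$ with edge set $E(H)\cup E(H')\cup\{\{i,j\} : i\in V(H),\ j\in V(H')\}$. The binomial edge ideal of a simple graph $G$ (with totally ordered vertex set) is $J_G=(x_iy_j-x_jy_i : \{i,j\}\in E(G),\ i<j)$. $\operatorname{Hilb}_M(t)=\sum_{k\ge0}\dim_K(M_k)t^k$ is the Hilbert series, $\dim$ is Krull dimension, and $e(M)$ is the multiplicity: if $\operatorname{Hilb}_M(t)=Q(t)/(1-t)^d$ with $d=\dim M$ and $Q$ a polynomial, then $e(M)=Q(1)$. *)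

(* Defs.v *)
From HB Require Import structures.
From mathcomp Require Import all_boot all_order all_algebra.
From mathcomp Require Import generic_quotient ring_quotient.
From mathcomp Require Import boolp.
From mathcomp Require Import mpoly.

Set Implicit Arguments.
Unset Strict Implicit.
Unset Printing Implicit Defensive.

Import GRing.Theory.
Local Open Scope ring_scope.
Local Open Scope quotient_scope.

Record fps (R : Type) := FPS { fps_coef : nat -> R }.

HB.instance Definition _ (R : Type) := gen_eqMixin (fps R).
HB.instance Definition _ (R : Type) := gen_choiceMixin (fps R).

Section FormalPowerSeries.
Variable R : comUnitRingType.
Implicit Types f g h : fps R.

Lemma fpsP f g : (forall n, fps_coef f n = fps_coef g n) -> f = g.
Proof. by case: f g => [f] [g] /= /funext ->. Qed.

Definition fps_zero : fps R := FPS (fun=> 0).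
Definition fps_opp f : fps R := FPS (fun n => - fps_coef f n).
Definition fps_add f g : fps R := FPS (fun n => fps_coef f n + fps_coef g n).
Definition fps_one : fps R := FPS (fun n => (n == 0%N)%:R).
Definition fps_mul f g : fps R :=
  FPS (fun n => \sum_(i < n.+1) fps_coef f i * fps_coef g (n - i)).

Fact fps_addA : associative fps_add.
Proof. by move=> f g h; apply: fpsP => n /=; rewrite addrA. Qed.
Fact fps_addC : commutative fps_add.
Proof. by move=> f g; apply: fpsP => n /=; rewrite addrC. Qed.
Fact fps_add0 : left_id fps_zero fps_add.
Proof. by move=> f; apply: fpsP => n /=; rewrite add0r. Qed.
Fact fps_addN : left_inverse fps_zero fps_opp fps_add.
Proof. by move=> f; apply: fpsP => n /=; rewrite addNr. Qed.

HB.instance Definition _ :=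
  GRing.isZmodule.Build (fps R) fps_addA fps_addC fps_add0 fps_addN.

Let trunc N f : {poly R} := \poly_(i < N.+1) fps_coef f i.

Let truncM N f g n : (n <= N)%N ->
  fps_coef (fps_mul f g) n = (trunc N f * trunc N g)`_n.
Proof.
move=> le_nN; rewrite coefM /=; apply: eq_bigr => i _.
have lt_iN : (i < N.+1)%N by rewrite ltnS (leq_trans _ le_nN) // -ltnS.
have lt_niN : (n - i < N.+1)%N by rewrite ltnS (leq_trans (leq_subr _ _)).
by rewrite !coef_poly lt_iN lt_niN.
Qed.

Fact fps_mulC : commutative fps_mul.
Proof.
by move=> f g; apply: fpsP => n; rewrite !(@truncM n) // mulrC.
Qed.

Fact fps_mulA : associative fps_mul.
Proof.
move=> f g h; apply: fpsP => n.
transitivity (trunc n f * (trunc n g * trunc n h))`_n.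
  rewrite coefM [LHS]/=; apply: eq_bigr => i _.
  by rewrite -(truncM g h (leq_subr _ _)) coef_poly ltn_ord.
rewrite mulrA coefM; apply/esym; rewrite [RHS]/=; apply: eq_bigr => i _.
have le_in : (i <= n)%N by rewrite -ltnS.
by rewrite -(truncM f g le_in) coef_poly ltnS leq_subr.
Qed.

Fact fps_mul1 : left_id fps_one fps_mul.
Proof.
move=> f; apply: fpsP => n /=.
rewrite big_ord_recl /= mul1r subn0 big1 ?addr0 // => i _.
by rewrite mul0r.
Qed.

Fact fps_mulDl : left_distributive fps_mul fps_add.
Proof.
move=> f g h; apply: fpsP => n /=; rewrite -big_split /=.
by apply: eq_bigr => i _; rewrite mulrDl.
Qed.

Fact fps_one_neq0 : fps_one != 0.
Proof.
apply/eqP => /(congr1 (fun f => fps_coef f 0)) /= /eqP.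
by rewrite oner_eq0.
Qed.

HB.instance Definition _ := GRing.Zmodule_isComNzRing.Build (fps R)
  fps_mulA fps_mulC fps_mul1 fps_mulDl fps_one_neq0.

(* The coefficients g 0, ..., g n of the inverse of f, in this order, from
   f 0 * g n = - (f 1 * g (n - 1) + ... + f n * g 0) for n > 0.             *)
Fixpoint fps_inv_seq (f : nat -> R) (n : nat) : seq R :=
  if n is m.+1 then
    let s := fps_inv_seq f m in
    rcons s (- (f 0%N)^-1 * \sum_(i < m.+1) f i.+1 * s`_(m - i))
  else [:: (f 0%N)^-1].

Definition fps_unit : {pred fps R} :=
  fun f => fps_coef f 0 \is a GRing.unit.

Definition fps_inv f : fps R :=
  if fps_unit f then FPS (fun n => (fps_inv_seq (fps_coef f) n)`_n) else f.

Let size_inv_seq (f : nat -> R) n : size (fps_inv_seq f n) = n.+1.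
Proof. by elim: n => //= n IHn; rewrite size_rcons IHn. Qed.

Let nth_inv_seq (f : nat -> R) n i : (i <= n)%N ->
  (fps_inv_seq f n)`_i = (fps_inv_seq f i)`_i.
Proof.
elim: n => [|n IHn]; first by rewrite leqn0 => /eqP->.
rewrite leq_eqVlt => /orP[/eqP-> //|]; rewrite ltnS => le_in.
by rewrite [fps_inv_seq f n.+1]/= nth_rcons size_inv_seq ltnS le_in IHn.
Qed.

Fact fps_mulV : {in fps_unit, left_inverse 1 fps_inv *%R}.
Proof.
move=> f uf; rewrite mulrC; apply: fpsP => n.
rewrite /fps_inv ifT //= big_ord_recl /=.
case: n => [|n]; first by rewrite big_ord0 addr0 divrr.
rewrite subn0 [fps_inv_seq _ n.+1]/= nth_rcons size_inv_seq ltnn eqxx.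
rewrite mulrA mulrN divrr // mulN1r; apply/eqP; rewrite addrC subr_eq0.
apply/eqP/eq_bigr => i _.
by rewrite /bump /= add1n subSS (nth_inv_seq _ (leq_subr i n)).
Qed.

Fact fps_unitP f g : g * f = 1 -> f \in fps_unit.
Proof.
move=> /(congr1 (fun f => fps_coef f 0)) /=.
rewrite big_ord_recl big_ord0 addr0 /= => gf1.
by apply/unitrPr; exists (fps_coef g 0); rewrite mulrC.
Qed.

Fact fps_inv_out : {in [predC fps_unit], fps_inv =1 id}.
Proof. by move=> f nuf; rewrite /fps_inv ifN. Qed.

HB.instance Definition _ := GRing.ComNzRing_hasMulInverse.Build (fps R)
  fps_mulV fps_unitP fps_inv_out.

Definition fps_poly (Q : {poly R}) : fps R := FPS (fun n => Q`_n).

End FormalPowerSeries.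

Notation "''t'" := (fps_poly 'X : fps int) (at level 0) : ring_scope.

(* The denominators (1 - t)^d are invertible, so that the fractions below
   are genuine quotients in Z[[t]].                                         *)
Lemma fps_1Bt_unit d : (1 - 't) ^+ d \is a GRing.unit.
Proof.
apply: unitrX; rewrite -[_ \is a _]/(fps_coef (1 - 't) 0 \is a GRing.unit).
by rewrite /= coefX.
Qed.

Definition gen_ideal (R : comNzRingType) (X : R -> Prop) : {pred R} :=
  fun f => `[< exists (m : nat) (a g : 'I_m -> R),
    (forall i, X (g i)) /\ f = \sum_(i < m) a i * g i >].

(* [idealr_closed] already requires 1 \notin P. *)
Definition prime_ideal (R : comNzRingType) (P : {pred R}) : Prop :=
  idealr_closed P /\ prime_idealr_closed P.

Definition has_prime_chain (R : comNzRingType) (d : nat) : Prop :=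
  exists P : 'I_d.+1 -> {pred R},
    (forall i, prime_ideal (P i)) /\
    (forall i j : 'I_d.+1, (i < j)%N ->
       {subset P i <= P j} /\ ~ {subset P j <= P i}).

Definition has_krull_dim (R : comNzRingType) (d : nat) : Prop :=
  has_prime_chain R d /\ (forall m, has_prime_chain R m -> (m <= d)%N).

Section QuotientLmodule.
Variables (K : fieldType) (A : comAlgType K) (I : idealr A).
Local Notation Q := {ideal_quot I}.

Definition quot_scale (c : K) (m : Q) : Q := \pi_Q (c%:A) * m.

Fact quot_scaleA c d m : quot_scale c (quot_scale d m) = quot_scale (c * d) m.
Proof. by rewrite /quot_scale mulrA -rmorphM /= -scalerAl mul1r scalerA. Qed.
Fact quot_scale1 : left_id 1 quot_scale.
Proof. by move=> m; rewrite /quot_scale scale1r rmorph1 mul1r. Qed.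
Fact quot_scaleDr : right_distributive quot_scale +%R.
Proof. by move=> c m1 m2; rewrite /quot_scale mulrDr. Qed.
Fact quot_scaleDl m : {morph quot_scale^~ m : c d / c + d}.
Proof. by move=> c d; rewrite /quot_scale scalerDl rmorphD mulrDl. Qed.

HB.instance Definition _ := GRing.Zmodule_isLmodule.Build K Q
  quot_scaleA quot_scale1 quot_scaleDr quot_scaleDl.

End QuotientLmodule.

Section Dimension.
Variables (K : fieldType) (V : lmodType K) (U : V -> Prop).

Definition is_basis (d : nat) (b : 'I_d -> V) : Prop :=
  [/\ forall i, U (b i),
      forall u, U u -> exists c : 'I_d -> K, u = \sum_(i < d) c i *: b i &
      forall c : 'I_d -> K, \sum_(i < d) c i *: b i = 0 -> forall i, c i = 0].

(* The dimension of the linear subspace U of V; by convention 0 when U is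
   infinite-dimensional.                                                    *)
Definition subspace_dim : nat :=
  if pselect (exists d, exists b : 'I_d -> V, is_basis b) is left exb
  then sval (cid exb) else 0%N.

End Dimension.

Section Hilbert.
Variables (K : fieldType) (n : nat) (I : idealr {mpoly K[n]}).
Local Notation M := {ideal_quot I}.

(* The degree k component of S/I (I homogeneous) is the image of S_k. *)
Definition graded_part (k : nat) (m : M) : Prop :=
  exists2 f : {mpoly K[n]}, f \is k.-homog & m = \pi_M f.

Definition Hilb : fps int := FPS (fun k => (subspace_dim (graded_part k))%:R).

Definition has_multiplicity (e : int) : Prop :=
  exists (d : nat) (Q : {poly int}),
    [/\ has_krull_dim M d, Hilb = fps_poly Q / (1 - 't) ^+ d & e = Q.[1]].

End Hilbert.

Record sgraph := SGraph {
  vertex :> finType;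
  adj : rel vertex;
  adj_sym : ssrbool.symmetric adj;
  adj_irr : irreflexive adj }.

Section PathGraph.
Variable p : nat.
Definition path_adj : rel 'I_p := fun i j => (i.+1 == j) || (j.+1 == i).
Fact path_adj_sym : ssrbool.symmetric path_adj.
Proof. by move=> i j; rewrite /path_adj orbC. Qed.
Fact path_adj_irr : irreflexive path_adj.
Proof. by move=> i; rewrite /path_adj orbb eqn_leq ltnn. Qed.
Definition path_graph := SGraph path_adj_sym path_adj_irr.
End PathGraph.

Section EdgelessGraph.
Variable q : nat.
Definition edgeless_adj : rel 'I_q := fun _ _ => false.
Fact edgeless_adj_sym : ssrbool.symmetric edgeless_adj. Proof. by []. Qed.
Fact edgeless_adj_irr : irreflexive edgeless_adj. Proof. by []. Qed.
Definition edgeless_graph := SGraph edgeless_adj_sym edgeless_adj_irr.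
End EdgelessGraph.

Section Join.
Variables H1 H2 : sgraph.
Definition join_adj : rel (H1 + H2)%type := fun u v =>
  match u, v with
  | inl i, inl j => adj i j
  | inr i, inr j => adj i j
  | _, _ => true
  end.
Fact join_adj_sym : ssrbool.symmetric join_adj.
Proof. by move=> [i|i] [j|j] //=; apply: adj_sym. Qed.
Fact join_adj_irr : irreflexive join_adj.
Proof. by move=> [i|i] /=; apply: adj_irr. Qed.
Definition graph_join := SGraph join_adj_sym join_adj_irr.
End Join.

Definition fan_graph (p q : nat) : sgraph :=
  graph_join (path_graph p) (edgeless_graph q).

Section BinomialEdgeIdeal.
Variables (K : fieldType) (G : sgraph).

(* The vertices are ordered by [enum_rank]; the variables are indexed so that
   the x_v come first and the y_v second.                                   *)
Local Notation S := {mpoly K[#|G| + #|G|]}.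

Definition xvar (v : G) : S := 'X_(lshift #|G| (enum_rank v)).
Definition yvar (v : G) : S := 'X_(rshift #|G| (enum_rank v)).

Definition edge_binomial (f : S) : Prop :=
  exists i j : G, [/\ adj i j, (enum_rank i < enum_rank j)%N &
                      f = xvar i * yvar j - xvar j * yvar i].

Definition binomial_edge_ideal : {pred S} := gen_ideal edge_binomial.

Fact binomial_edge_ideal_closed : idealr_closed binomial_edge_ideal.
Proof.
split.
- by apply/asboolP; exists 0%N, (fun=> 0), (fun=> 0); rewrite big_ord0; split => // -[].
- apply/asboolP => -[m [a [g [gE /(congr1 (mcoeff 0%MM))]]]].
  apply/eqP; rewrite mcoeff1 eqxx raddf_sum big1 ?oner_eq0 // => i _ /=.
  have [u [v [_ _ ->]]] := gE i.
  have mc0 : {morph (mcoeff (R := K) 0%MM : S -> K) : x y / x * y}.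
    by move=> x y; exact: rmorphM.
  rewrite mc0 mcoeffB !mc0 /xvar /yvar !mcoeffX.
  by rewrite !mnm1_eq0 !mul0r subrr mulr0.
- move=> c f g /asboolP[m [a [u [uE ->]]]] /asboolP[k [b [v [vE ->]]]].
  apply/asboolP; exists (m + k)%N.
  exists (fun i => match split i with inl i => c * a i | inr i => b i end).
  exists (fun i => match split i with inl i => u i | inr i => v i end).
  split; first by move=> i; case: split.
  rewrite big_split_ord mulr_sumr /=; congr (_ + _); apply: eq_bigr => i _.
    by rewrite (unsplitK (inl i : 'I_m + 'I_k)) mulrA.
  by rewrite (unsplitK (inr i : 'I_m + 'I_k)).
Qed.

HB.instance Definition _ :=
  isIdealr.Build S binomial_edge_ideal binomial_edge_ideal_closed.

End BinomialEdgeIdeal.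

Arguments binomial_edge_ideal : clear implicits.

(* Main.v *)
Require Import Defs.
From HB Require Import structures.
From mathcomp Require Import all_boot all_order all_algebra.
From mathcomp Require Import generic_quotient ring_quotient.
From mathcomp Require Import boolp.
From mathcomp Require Import mpoly.
From mathcomp Require Import zify ring.

Set Implicit Arguments.
Unset Strict Implicit.
Unset Printing Implicit Defensive.

Import GRing.Theory.
Local Open Scope ring_scope.

(* The ring S/J_G is graded by multidegree in N^V (deg x_v = deg y_v = e_v), and
   J_G is spanned by differences of monomials, so S/J_G has a basis indexed by
   the classes of monomials under the moves x_u y_v <-> x_v y_u along edges.
   For the fan graph:
   - in a multidegree alpha whose support meets both sides of the join, the
     Pluecker relation x_z f_uv = x_u f_zv - x_v f_zu makes all monomials with
     the same total y-degree congruent, which gives |alpha| + 1 classes, as for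
     the complete graph;
   - in the other multidegrees, each class has exactly one monomial without a
     factor x_i y_(i+1), i and i+1 being consecutive on the path.
   Counting both families gives the Hilbert series.

   For the dimension, a chain of primes of length m in S/J_G yields at least
   (r + 1)^m independent elements of degree O(r), while the series, of the form
   Q / (1 - t)^d, allows only O(r^d) of them.  Chains of length 2q and p + q + 1
   come from the minimal primes (x_v, y_v : v in the path), whose quotient is a
   polynomial ring, and J_(K_n), whose quotient is K[a_v, t a_v].             *)

(** * Power series *)

Section PowerSeries.
Variable R : comUnitRingType.
Implicit Types (f g : fps R) (P Q : {poly R}).

Lemma fps_coefD f g n : fps_coef (f + g) n = fps_coef f n + fps_coef g n.
Proof. by []. Qed.

Lemma fps_coefN f n : fps_coef (- f) n = - fps_coef f n.
Proof. by []. Qed.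

Lemma fps_coefM f g n :
  fps_coef (f * g) n = \sum_(i < n.+1) fps_coef f i * fps_coef g (n - i).
Proof. by []. Qed.

Lemma fps_coef1 n : fps_coef (1 : fps R) n = (n == 0%N)%:R.
Proof. by []. Qed.

Fact fps_poly_is_zmod_morphism : zmod_morphism (@fps_poly R).
Proof. by move=> P Q; apply: fpsP => n; rewrite /= coefB. Qed.

Fact fps_poly_is_monoid_morphism : monoid_morphism (@fps_poly R).
Proof.
split=> [|P Q]; apply: fpsP => n; first by rewrite /= coef1.
by rewrite /= coefM.
Qed.

HB.instance Definition _ :=
  GRing.isZmodMorphism.Build {poly R} (fps R) (@fps_poly R)
    fps_poly_is_zmod_morphism.
HB.instance Definition _ :=
  GRing.isMonoidMorphism.Build {poly R} (fps R) (@fps_poly R)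
    fps_poly_is_monoid_morphism.

(** The coefficient at [k] of a product involves only coefficients of index at most [k]. Each factor
    may thus be replaced by the polynomial with terms w i x t^(dg x), and distributivity expands the
    product into a sum over choice functions. *)
Lemma coef_prod_fps (I J : finType) (k : nat) (f : I -> fps R)
    (dg : J -> nat) (w : I -> J -> R) :
    (forall i j, (j <= k)%N ->
       fps_coef (f i) j = \sum_(x | dg x == j) w i x) ->
  fps_coef (\prod_i f i) k =
    \sum_(s : {ffun I -> J} | (\sum_i dg (s i) == k)%N) \prod_i w i (s i).
Proof.
move=> fE; pose P i := \sum_x w i x *: 'X^(dg x).
have PE i j : (j <= k)%N -> fps_coef (f i) j = (P i)`_j.
  move=> le_jk; rewrite fE // coef_sum big_mkcond /=; apply: eq_bigr => x _.
  by rewrite coefZ coefXn eq_sym; case: eqP; rewrite ?mulr1 ?mulr0.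
have: forall j, (j <= k)%N -> fps_coef (\prod_i f i) j = (\prod_i P i)`_j.
  apply: (big_ind2 (fun g Q => forall j, (j <= k)%N -> fps_coef g j = Q`_j)).
  - by move=> j _; rewrite coef1.
  - move=> g1 Q1 g2 Q2 E1 E2 j le_jk; rewrite coefM fps_coefM.
    apply: eq_bigr => i _; rewrite E1 ?E2 //; first exact: leq_trans (leq_subr _ _) _.
    by rewrite (leq_trans _ le_jk) // -ltnS.
  - by move=> i _ j; exact: PE.
move=> /(_ k (leqnn k)) ->; rewrite /P bigA_distr_bigA coef_sum [RHS]big_mkcond /=.
apply: eq_bigr => s _; rewrite scaler_prod prodrXr coefZ coefXn eq_sym.
by case: eqP; rewrite ?mulr1 ?mulr0.
Qed.

End PowerSeries.

Local Notation geom := ((1 - 't)^-1).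

Lemma coef_geom n : fps_coef geom n = 1.
Proof.
suff -> : geom = FPS (fun=> 1) by [].
have u := fps_1Bt_unit 1; rewrite expr1 in u.
apply: (mulrI u); rewrite divrr //; apply: fpsP => -[|k].
  by rewrite fps_coefM big_ord_recl big_ord0 /= coefX.
rewrite fps_coefM 2!big_ord_recl big1 ?addr0 => [|i _].
  by rewrite /= !coefX.
by rewrite /= coefX.
Qed.

(** The Euler operator t d/dt, a derivation. *)
Definition fps_theta (f : fps int) : fps int :=
  FPS (fun k => k%:R * fps_coef f k).

Lemma fps_thetaM f g :
  fps_theta (f * g) = fps_theta f * g + f * fps_theta g.
Proof.
apply: fpsP => n; rewrite fps_coefD !fps_coefM /= mulr_sumr -big_split /=.
apply: eq_bigr => i _.
have -> : n%:R = i%:R + (n - i)%:R :> int by rewrite -natrD subnKC // -ltnS.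
by ring.
Qed.

Lemma mulVr_1Bt : geom * (1 - 't) = 1.
Proof. by apply: mulVr; have := fps_1Bt_unit 1; rewrite expr1. Qed.

(** Apply the derivation to [geom * (1 - 't) = 1], then divide by [1 - 't]. *)
Lemma theta_geom : fps_theta geom = 't * geom ^+ 2.
Proof.
have t1 : fps_theta 1 = 0.
  by apply: fpsP => -[|k] /=; rewrite ?mul0r ?mulr0.
have tt : fps_theta (1 - 't) = - 't.
  apply: fpsP => k; rewrite fps_coefN /= coefX.
  by case: k => [|[|k]]; rewrite /= ?mul0r ?subrr ?sub0r ?mulr0 ?mul1r ?oppr0.
have := fps_thetaM geom (1 - 't); rewrite mulVr_1Bt t1 tt => E.
have {}E : fps_theta geom * (1 - 't) = 't * geom.
  transitivity (fps_theta geom * (1 - 't) + geom * - 't + 't * geom); first by ring.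
  by rewrite -E add0r.
transitivity (fps_theta geom * (1 - 't) * geom); last by rewrite E; ring.
by rewrite -mulrA [X in _ * X]mulrC mulVr_1Bt mulr1.
Qed.

Lemma theta_geomX m : fps_theta (geom ^+ m) = m%:R * 't * geom ^+ m.+1.
Proof.
elim: m => [|m IHm].
  by rewrite expr0 !mul0r; apply: fpsP => -[|k] /=; rewrite ?mul0r ?mulr0.
rewrite exprS fps_thetaM IHm theta_geom -natr1 !exprS.
by move: (geom ^+ m) m%:R => g c; ring.
Qed.

(** A mixed multidegree of degree k carries k + 1 classes, so its count is weighted by k + 1, which
    is the operator 1 + t d/dt. This is the origin of the numerators (m - 1)t + 1 of the Hilbert
    series. *)
Lemma succ_weighted_geomX m :
  FPS (fun k => k.+1%:R * fps_coef (geom ^+ m) k) =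
    ((m%:R - 1) * 't + 1) * geom ^+ (m + 1).
Proof.
transitivity (geom ^+ m + fps_theta (geom ^+ m)).
  by apply: fpsP => k; rewrite fps_coefD /= -natr1 mulrDl mul1r addrC.
rewrite theta_geomX addn1 exprS.
transitivity ((geom * (1 - 't)) * geom ^+ m + m%:R * 't * (geom * geom ^+ m)).
  by rewrite mulVr_1Bt mul1r.
by ring.
Qed.

(** * Bases of monomials and Krull dimension of quotients *)

Section LinearDependence.
Variables (K : fieldType) (V : lmodType K).

(** The matrix of coordinates has more rows than columns, so its left kernel is nonzero. *)
Lemma linear_dependence (T : finType) (d : nat) (u : 'I_d -> V) (w : T -> V) :
    (forall i, exists c : T -> K, u i = \sum_t c t *: w t) -> (#|T| < d)%N ->
  exists2 c : 'I_d -> K, \sum_i c i *: u i = 0 & exists i, c i != 0.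
Proof.
move=> span ltTd; have [c cE] := choice span.
pose A := \matrix_(i < d, j < #|T|) c i (enum_val j).
have : kermx A != 0.
  by rewrite -mxrank_eq0 mxrank_ker subn_eq0 -ltnNge (leq_ltn_trans (rank_leq_col A)).
case/rowV0Pn => v /sub_kermxP vA0 /rV0Pn[i vi0].
exists (v 0) => [|]; last by exists i.
under eq_bigr do rewrite cE scaler_sumr.
rewrite exchange_big big1 //= => t _.
under eq_bigr do rewrite scalerA.
have := congr1 (fun M : 'rV_#|T| => M 0 (enum_rank t)) vA0; rewrite !mxE => vAt.
rewrite -scaler_suml [X in X *: _](_ : _ = 0) ?scale0r // -[RHS]vAt.
by apply: eq_bigr => i' _; rewrite mxE enum_rankK.
Qed.

End LinearDependence.

Section SubspaceDim.
Variables (K : fieldType) (V : lmodType K) (U : V -> Prop).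

Lemma basis_size_le d1 d2 (b1 : 'I_d1 -> V) (b2 : 'I_d2 -> V) :
  is_basis U b1 -> is_basis U b2 -> (d1 <= d2)%N.
Proof.
move=> [U1 _ free1] [_ span2 _]; rewrite leqNgt; apply/negP => lt21.
have [||c /free1 c0 [i]] := @linear_dependence _ _ 'I_d2 d1 b1 b2.
- by move=> i; apply/span2/U1.
- by rewrite card_ord.
by rewrite c0 eqxx.
Qed.

Lemma subspace_dimE d (b : 'I_d -> V) : is_basis U b -> subspace_dim U = d.
Proof.
move=> b_basis; rewrite /subspace_dim; case: pselect => [exb|[]]; last by exists d, b.
case: cid => d' /= [b' b'_basis]; apply/eqP; rewrite eqn_leq.
by rewrite (basis_size_le b'_basis b_basis) (basis_size_le b_basis b'_basis).
Qed.

End SubspaceDim.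

Section Quotient.
Variables (K : fieldType) (n : nat) (I : idealr {mpoly K[n]}).
Local Notation S := {mpoly K[n]}.
Local Notation A := {ideal_quot I}.
Local Notation pi := (\pi_A%qT : S -> A).

Lemma quot_piZ c (f : S) : pi (c *: f) = c *: pi f.
Proof.
have -> : c *: f = c%:A * f by rewrite -scalerAl mul1r.
by rewrite rmorphM.
Qed.

Lemma quot_pi_eq0 (f : S) : (pi f == 0) = (f \in I).
Proof. by rewrite -(rmorph0 pi) -Quotient.idealrBE subr0. Qed.

Lemma quot_pi_sumZ (J : finType) (P : pred J) (c : J -> K) (f : J -> S) :
  pi (\sum_(j | P j) c j *: f j) = \sum_(j | P j) c j *: pi (f j).
Proof. by rewrite rmorph_sum; apply: eq_bigr => j _; rewrite /= quot_piZ. Qed.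

(* The functionals [f |-> \sum_(m | h m == c) f@_m] separate the monomials
   [mon t], hence these are independent modulo [I].                         *)
Lemma monomial_basis (k : nat) (T : finType) (B : {pred T})
    (mon : T -> 'X_{1..n}) (C : eqType) (h : 'X_{1..n} -> C) :
    (forall f, f \in I -> forall c,
       \sum_(m : 'X_{1..n < k.+1} | h m == c) f@_m = 0) ->
    {in B, forall t, mdeg (mon t) = k} ->
    (forall m, mdeg m = k ->
       exists2 t, t \in B & pi 'X_[m] = pi 'X_[mon t]) ->
    {in B &, injective (h \o mon)} ->
  is_basis (@graded_part K n I k) (fun i : 'I_#|B| => pi 'X_[mon (enum_val i)]).
Proof.
move=> hI mon_deg mon_span mon_inj; split=> [i|u [f f_hom ->]|c].
- by exists 'X_[mon (enum_val i)]; rewrite // dhomogX /= mon_deg // enum_valP.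
- rewrite (mpolyE f) rmorph_sum big_seq /=.
  elim/big_ind: _ => [|x y [cx ->] [cy ->]|m m_f].
  + by exists (fun=> 0); rewrite big1 // => i _; rewrite scale0r.
  + exists (fun i => cx i + cy i); rewrite -big_split.
    by apply: eq_bigr => i _; rewrite scalerDl.
  + have [t tB mE] := mon_span m (dhomog_mf f_hom m_f).
    exists (fun i => f@_m * (i == enum_rank_in tB t)%:R); rewrite quot_piZ.
    rewrite (bigD1 (enum_rank_in tB t)) //= big1 ?addr0 => [|i /negPf->].
      by rewrite eqxx mulr1 enum_rankK_in // mE.
    by rewrite mulr0 scale0r.
- rewrite -quot_pi_sumZ => /eqP; rewrite quot_pi_eq0 => fI i.
  have := hI _ fI (h (mon (enum_val i))).
  have deg_lt j : (mdeg (mon (@enum_val T B j)) < k.+1)%N.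
    by rewrite mon_deg ?enum_valP.
  rewrite (bigD1 (BMultinom (deg_lt i))) //= raddf_sum (bigD1 i) //= mcoeffZ.
  rewrite mcoeffX eqxx mulr1 big1 ?addr0 => [|j ne_ji]; last first.
    rewrite mcoeffZ mcoeffX; case: eqP => [e|]; last by rewrite mulr0.
    case/eqP: ne_ji; apply: enum_val_inj; apply: mon_inj; rewrite ?enum_valP //=.
    by rewrite e.
  rewrite big1 ?addr0 // => m /andP[/eqP hm ne_m].
  rewrite raddf_sum big1 // => j _; rewrite /= mcoeffZ mcoeffX.
  case: eqP => [e|]; last by rewrite mulr0.
  case/eqP: ne_m; apply/val_inj; rewrite /= -e; congr (mon _).
  by apply: mon_inj; rewrite ?enum_valP //= e.
Qed.

End Quotient.

(** * Upper bound for the Krull dimension by counting independent elements *)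

Section KrullDimension.
Variables (K : fieldType) (n : nat) (I : idealr {mpoly K[n]}).
Local Notation S := {mpoly K[n]}.
Local Notation A := {ideal_quot I}.
Local Notation pi := (\pi_A%qT : S -> A).
Implicit Types P Q : {pred A}.

(** The quotient by [P] contains [d] independent classes of polynomials of degree at most [k];
    [msize] is the degree plus one. The elements are taken in S, where the degree is available. *)
Definition free_mod P (k d : nat) : Prop :=
  exists g : 'I_d -> S, (forall i, (msize (g i) <= k.+1)%N) /\
    forall c : 'I_d -> K, pi (\sum_i c i *: g i) \in P -> forall i, c i = 0.

Lemma free_mod_widen P k k' d : (k <= k')%N -> free_mod P k d -> free_mod P k' d.
Proof.
move=> le_kk' [g [g_size g_free]]; exists g; split=> // i.
by rewrite (leq_trans (g_size i)).
Qed.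

Lemma free_mod_sub P Q k d : {subset P <= Q} -> free_mod Q k d -> free_mod P k d.
Proof.
by move=> sPQ [g [g_size g_free]]; exists g; split=> // c /sPQ; apply: g_free.
Qed.

(** The family consists of the g_j and the f h_j. If G + f H lies in P, then G lies in Q because f
    does, and the coefficients of the g_j vanish. Then f H lies in P and f does not, so H lies in P
    by primality. *)
Lemma free_mod_add P Q (f : S) e k d k' d' :
    prime_ideal P -> prime_ideal Q -> {subset P <= Q} ->
    pi f \in Q -> pi f \notin P -> (msize f <= e.+1)%N ->
    free_mod Q k d -> free_mod P k' d' -> (k <= k' + e)%N ->
  free_mod P (k' + e) (d + d').
Proof.
move=> [[P0 _ _] primeP] [[_ _ Qlin] _] sPQ fQ fP f_size [g [g_size g_free]]
  [h [h_size h_free]] le_k.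
exists (fun i => match split i with inl j => g j | inr j => f * h j end).
split=> [i|c].
  case: split => j; first by rewrite (leq_trans (g_size j)).
  have [->|h0] := eqVneq (h j) 0; first by rewrite mulr0 msize0.
  have f0 : f != 0.
    by apply: contraNneq fP => ->; rewrite rmorph0.
  rewrite msizeM // -subn1 leq_subLR (leq_trans (leq_add f_size (h_size j))) //; lia.
rewrite big_split_ord /=.
under eq_bigr do rewrite (unsplitK (inl _ : 'I_d + 'I_d')) /=.
under [X in _ + X]eq_bigr do rewrite (unsplitK (inr _ : 'I_d + 'I_d')) /= scalerAr.
rewrite -mulr_sumr; set G := \sum_i _; set H := \sum_i _ => sumP.
have gc0 : forall i, c (lshift d' i) = 0.
  apply: g_free; rewrite -/G.
  have := Qlin (- pi H) _ _ fQ (sPQ _ sumP).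
  by rewrite rmorphD rmorphM /= mulNr [_ * pi f]mulrC addrCA addNr addr0.
have hc0 : forall i, c (rshift d i) = 0.
  apply: h_free; rewrite -/H.
  move: sumP; rewrite /G big1 ?add0r => [|i _]; last by rewrite gc0 scale0r.
  by rewrite rmorphM => /primeP /orP[|//]; rewrite (negPf fP).
by move=> i; rewrite -[i]splitK; case: split.
Qed.

(* Multiplying by powers of [f] shows that the dimension of the polynomials of
   bounded degree modulo [P] grows by one order faster than modulo [Q].     *)
Lemma free_mod_iter P Q (f : S) e k d r :
    prime_ideal P -> prime_ideal Q -> {subset P <= Q} ->
    pi f \in Q -> pi f \notin P -> (msize f <= e.+1)%N ->
  free_mod Q k d -> free_mod P (k + r * e) (r.+1 * d).
Proof.
move=> primeP primeQ sPQ fQ fP f_size Qfree; elim: r => [|r IHr].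
  by rewrite mul0n addn0 mul1n; apply: free_mod_sub Qfree.
rewrite mulSn addnCA addnC mulSn.
by apply: free_mod_add fQ fP f_size Qfree IHr _ => //; lia.
Qed.

(** Induction from the top of the chain: each strict inclusion supplies an element of the larger
    prime outside the smaller one, whose powers multiply the number of independent elements by r +
    1. *)
Lemma prime_chain_free_mod m (P : nat -> {pred A}) :
    (forall i, (i <= m)%N -> prime_ideal (P i)) ->
    (forall i, (i < m)%N -> {subset P i <= P i.+1} /\ ~ {subset P i.+1 <= P i}) ->
  exists e, forall r, free_mod (P 0%N) (m * (r * e)) (r.+1 ^ m).
Proof.
elim: m P => [|m IHm] P primeP chainP.
  (* Modulo a single prime the constant 1 is independent: a nonzero constant in the ideal would make
     1 a member. *)
  exists 0%N => r; rewrite expn0; exists (fun=> 1); split=> [i|c]; first by rewrite msize1.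
  rewrite big_ord_recl big_ord0 addr0 => c1P i; rewrite (ord1 i).
  apply/eqP; apply: contraTT c1P => c0; apply/negP => c1P.
  have [[P0 P1 Plin] _] := primeP 0%N isT.
  case/negP: P1; have := Plin (pi (c ord0)^-1%:MP) _ _ c1P P0.
  rewrite addr0 -rmorphM /= -mul_mpolyC mulr1 -mpolyCM mulVf //.
  by rewrite mpolyC1 rmorph1.
have [e eP] := IHm (P \o succn) (fun i => primeP i.+1) (fun i => chainP i.+1).
have [sP /existsNP[u /not_implyP[uP1 uP0]]] := chainP 0%N isT.
have [f fE] : exists f, u = pi f by exists (repr u); rewrite reprK.
(* One degree bound must serve both [f] and the primes above it, and it may not depend on [r]. *)
exists (maxn e (msize f)) => r.
rewrite mulSn addnC expnS.
apply: (@free_mod_iter _ (P 1%N) f) => //; rewrite -?fE //.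
- exact: primeP.
- exact: primeP.
- exact/negP.
- by rewrite leqW // leq_maxr.
apply: free_mod_widen (eP r); rewrite !leq_mul2l leq_maxl orbT.
by rewrite !orbT.
Qed.

(** Modulo I, the polynomials of degree at most [k] are spanned by the bases of the graded parts 0
    to [k]. A larger family satisfies a nontrivial relation already in A, and 0 belongs to P. *)
Lemma free_mod_card P k d (D : nat -> nat) (b : forall j, 'I_(D j) -> A) :
    (forall j, is_basis (@graded_part K n I j) (@b j)) ->
    idealr_closed P -> free_mod P k d ->
  (d <= \sum_(j < k.+1) D j)%N.
Proof.
move=> b_basis [P0 _ _] [g [g_size g_free]]; rewrite leqNgt; apply/negP => lt_d.
pose T := {j : 'I_k.+1 & 'I_(D j)}.
have cardT : #|{: T}| = (\sum_(j < k.+1) D j)%N.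
  by rewrite card_tagged sumnE big_map enumT; apply: eq_bigr => j _; rewrite card_ord.
pose w (t : T) := b _ (tagged t).
have span i : exists c : T -> K, pi (g i) = \sum_t c t *: w t.
  rewrite (mpolyE (g i)) rmorph_sum big_seq /=.
  elim/big_ind: _ => [|x y [cx ->] [cy ->]|m m_g].
  + by exists (fun=> 0); rewrite big1 // => t _; rewrite scale0r.
  + exists (fun t => cx t + cy t); rewrite -big_split.
    by apply: eq_bigr => t _; rewrite scalerDl.
  have lt_mk : (mdeg m < k.+1)%N.
    by rewrite (leq_trans (msize_mdeg_lt m_g)).
  have [_ span _] := b_basis (Ordinal lt_mk).
  have [|c cE] := span (pi ('X_[m])); first by exists 'X_[m]; rewrite // dhomogX /=.
  pose T_ (j : 'I_k.+1) := 'I_(D j).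
  (* Coordinates in the basis of the degree of [m]; [untag] returns 0 in the other degrees. *)
  exists (fun t => (g i)@_m * untag (T_ := T_) 0 c t).
  rewrite quot_piZ cE scaler_sumr.
  rewrite -(@sig_big_dep _ _ _ _ T_ xpredT (fun _ => xpredT)
    (fun j x => ((g i)@_m * untag (T_ := T_) 0 c (Tagged T_ x)) *: b j x)) /=.
  rewrite (bigD1 (Ordinal lt_mk)) //= [X in _ + X]big1 ?addr0 => [|j ne_j].
    apply: eq_bigr => x _; rewrite scalerA; congr (_ * _ *: _).
    by rewrite (@untagE _ T_ _ 0 _ c (@Tagged _ (Ordinal lt_mk) T_ x) (erefl _)).
  by rewrite big1 // => x _; rewrite untag_dflt // mulr0 scale0r.
have [|c cu0 [i ci]] := linear_dependence span; first by rewrite cardT.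
by case/eqP: ci; apply: g_free; rewrite quot_pi_sumZ cu0.
Qed.

Lemma krull_dim_le (D : nat -> nat) (b : forall j, 'I_(D j) -> A) (C d m : nat) :
    (forall j, is_basis (@graded_part K n I j) (@b j)) ->
    (forall k, (\sum_(j < k.+1) D j <= C * k.+1 ^ d)%N) ->
  has_prime_chain A m -> (m <= d)%N.
Proof.
move=> b_basis leD [P [primeP chainP]]; rewrite leqNgt; apply/negP => lt_dm.
have [||e eP] := @prime_chain_free_mod m (fun i => P (inord i)).
- by move=> i _; exact: primeP.
- by move=> i lt_im; apply: chainP; rewrite !inordK // ltnS // ltnW.
have [ideal0 _] := primeP (inord 0).
have bound r : (r.+1 ^ m <= C * (m * e).+1 ^ d * r.+1 ^ d)%N.
  apply: leq_trans (free_mod_card b_basis ideal0 (eP r)) _.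
  apply: leq_trans (leD _) _; rewrite -mulnA -expnMn leq_mul2l; apply/orP; right.
  by case: d {leD lt_dm} => // d; rewrite leq_exp2r //; lia.
set M := (C * (m * e).+1 ^ d)%N in bound.
(* At r = M the bound gives (M + 1)^(d + 1) <= M (M + 1)^d, a contradiction. *)
have := leq_trans (leq_pexp2l (ltn0Sn M) lt_dm) (bound M).
by rewrite expnS leq_pmul2r ?expn_gt0 // ltnn.
Qed.

End KrullDimension.

Lemma sum_mcoeffX (R : nzRingType) (n k : nat) (P : pred 'X_{1..n}) m :
  \sum_(m' : 'X_{1..n < k} | P m') ('X_[m] : {mpoly R[n]})@_m' =
    ((mdeg m < k)%N && P m)%:R.
Proof.
case: ltnP => [lt_mk|le_km] /=; last first.
  rewrite big1 // => m' _; rewrite mcoeffX; case: eqP => // e.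
  by move: (bmdeg m'); rewrite -e ltnNge le_km.
have [Pm|nPm] := boolP (P m).
  rewrite (bigD1 (BMultinom lt_mk)) //= mcoeffX eqxx big1 ?addr0 // => m' /andP[_ ne].
  rewrite mcoeffX; case: eqP => // e; case/eqP: ne.
  exact/val_inj/esym.
rewrite big1 // => m' Pm'; rewrite mcoeffX; case: eqP => // e.
by rewrite e Pm' in nPm.
Qed.

(** * Monomials modulo a binomial edge ideal *)

Section GraphMonomials.
Variables (K : fieldType) (G : sgraph).
Local Notation N := (#|G| + #|G|)%N.
Local Notation S := {mpoly K[N]}.
Local Notation J := (binomial_edge_ideal K G).
Local Notation A := {ideal_quot J}.
Local Notation pi := (\pi_A%qT : S -> A).

Definition xexp (m : 'X_{1..N}) (v : G) : nat := m (lshift _ (enum_rank v)).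
Definition yexp (m : 'X_{1..N}) (v : G) : nat := m (rshift _ (enum_rank v)).

Definition xymon (a b : G -> nat) : 'X_{1..N} :=
  [multinom match split i with
            | inl j => a (enum_val j)
            | inr j => b (enum_val j)
            end | i < N].

Lemma xexp_xymon a b : xexp (xymon a b) = a.
Proof.
by apply/funext => v; rewrite /xexp mnmE (unsplitK (inl _ : 'I_#|G| + 'I_#|G|)) enum_rankK.
Qed.

Lemma yexp_xymon a b : yexp (xymon a b) = b.
Proof.
by apply/funext => v; rewrite /yexp mnmE (unsplitK (inr _ : 'I_#|G| + 'I_#|G|)) enum_rankK.
Qed.

Lemma xymonK m : xymon (xexp m) (yexp m) = m.
Proof.
apply/mnmP => i; rewrite mnmE /xexp /yexp -[in RHS](splitK i).
by case: split => j; rewrite /= enum_valK.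
Qed.

Lemma big_vertices (R : Type) (idx : R) (op : Monoid.com_law idx)
    (F : 'I_N -> R) :
  \big[op/idx]_i F i =
    \big[op/idx]_(v : G) op (F (lshift _ (enum_rank v))) (F (rshift _ (enum_rank v))).
Proof.
rewrite big_split_ord big_split /=.
by congr (op _ _); rewrite (reindex (@enum_rank G)) //; apply: onW_bij;
  exact: enum_rank_bij.
Qed.

Lemma mdeg_xymon a b : mdeg (xymon a b) = (\sum_v (a v + b v))%N.
Proof.
rewrite mdegE big_vertices; apply: eq_bigr => v _.
by rewrite -/(xexp _ v) -/(yexp _ v) xexp_xymon yexp_xymon.
Qed.

Definition qx v : A := pi (xvar K v).
Definition qy v : A := pi (yvar K v).

Definition qmon (a b : G -> nat) : A := \prod_v (qx v ^+ a v * qy v ^+ b v).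

Lemma pi_xymon a b : pi 'X_[xymon a b] = qmon a b.
Proof.
rewrite mpolyXE_id rmorph_prod /= big_vertices; apply: eq_bigr => v _.
by rewrite -/(xexp _ v) -/(yexp _ v) xexp_xymon yexp_xymon !rmorphXn.
Qed.

Lemma qx_qy_adj u v : adj u v -> qx u * qy v = qx v * qy u.
Proof.
wlog lt_uv : u v / (enum_rank u < enum_rank v)%N => [IH uv|uv].
  have [lt_uv|lt_vu|/val_inj/enum_rank_inj e] := ltngtP (enum_rank u) (enum_rank v).
  - exact: IH.
  - by apply/esym/IH; rewrite // adj_sym.
  - by rewrite e.
apply/eqP; rewrite -subr_eq0 /qx /qy -!rmorphM -rmorphB /= quot_pi_eq0.
apply/asboolP; exists 1%N, (fun=> 1), (fun=> xvar K u * yvar K v - xvar K v * yvar K u).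
by split=> [_|]; [exists u, v | rewrite big_ord1 mul1r].
Qed.

(** The ideal is spanned by products of a monomial and an edge binomial. The two monomials of such a
    product have the same degree and the same value of [h], so they are both counted, with opposite
    signs, or both omitted. *)
Lemma class_functional (k : nat) (C : eqType) (h : 'X_{1..N} -> C) :
    (forall m u v, adj u v ->
       h (U_(lshift #|G| (enum_rank u)) + U_(rshift #|G| (enum_rank v)) + m)%MM =
       h (U_(lshift #|G| (enum_rank v)) + U_(rshift #|G| (enum_rank u)) + m)%MM) ->
  forall f : S, f \in J -> forall c,
    \sum_(m : 'X_{1..N < k.+1} | h m == c) f@_m = 0.
Proof.
move=> h_adj f /asboolP[r [a [g [gE ->]]]] c.
under eq_bigr do rewrite raddf_sum.
rewrite exchange_big big1 //= => i _; have [u [v [uv _ ->]]] := gE i.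
rewrite {1}(mpolyE (a i)) mulr_suml.
under eq_bigr do rewrite raddf_sum.
rewrite exchange_big big1 //= => m _.
under eq_bigr do rewrite -scalerAl mcoeffZ.
rewrite -mulr_sumr mulrBr /xvar /yvar -!mpolyXD.
under eq_bigr do rewrite mcoeffB.
rewrite sumrB.
rewrite !(sum_mcoeffX K _ (fun m' => h m' == c)) !(addmC m) h_adj // !mdegD !mdeg1 subrr mulr0 //.
Qed.

(** The form of [monomial_basis] used for graphs: [h] is an invariant of the moves along edges, and
    [mon] lists representatives that reach every class and are separated by [h]. *)
Lemma graph_basis (k : nat) (T : finType) (B : {pred T})
    (mon : T -> (G -> nat) * (G -> nat)) (C : eqType)
    (h : (G -> nat) -> (G -> nat) -> C) :
    (forall a b u v, adj u v ->
       h (fun w => ((w == u) + a w)%N) (fun w => ((w == v) + b w)%N) =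
       h (fun w => ((w == v) + a w)%N) (fun w => ((w == u) + b w)%N)) ->
    {in B, forall t, \sum_v ((mon t).1 v + (mon t).2 v) = k}%N ->
    (forall a b, (\sum_v (a v + b v))%N = k ->
       exists2 t, t \in B & qmon a b = qmon (mon t).1 (mon t).2) ->
    {in B &, injective (fun t => h (mon t).1 (mon t).2)} ->
  is_basis (@graded_part K _ J k)
    (fun i : 'I_#|B| => qmon (mon (enum_val i)).1 (mon (enum_val i)).2).
Proof.
move=> h_adj mon_deg mon_span mon_inj.
have -> : (fun i : 'I_#|B| => qmon (mon (enum_val i)).1 (mon (enum_val i)).2) =
    (fun i : 'I_#|B| => pi 'X_[xymon (mon (enum_val i)).1 (mon (enum_val i)).2]).
  by apply/funext => i; rewrite pi_xymon.
apply: (@monomial_basis K _ J k T B (fun t => xymon (mon t).1 (mon t).2) C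
  (fun m => h (xexp m) (yexp m))).
- apply: (@class_functional k C (fun m => h (xexp m) (yexp m))) => m u v uv.
  have xE w w' : xexp (U_(lshift #|G| (enum_rank w)) + U_(rshift #|G| (enum_rank w')) + m)%MM =
      (fun z => ((z == w) + xexp m z)%N).
    apply/funext => z; rewrite /xexp !mnmDE !mnm1E eq_lshift eq_rlshift addn0.
    by rewrite (inj_eq enum_rank_inj) eq_sym.
  have yE w w' : yexp (U_(lshift #|G| (enum_rank w)) + U_(rshift #|G| (enum_rank w')) + m)%MM =
      (fun z => ((z == w') + yexp m z)%N).
    apply/funext => z; rewrite /yexp !mnmDE !mnm1E eq_rshift eq_lrshift add0n.
    by rewrite (inj_eq enum_rank_inj) eq_sym.
  by rewrite !xE !yE h_adj.
- by move=> t tB; rewrite mdeg_xymon mon_deg.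
- move=> m; rewrite -(xymonK m) mdeg_xymon => /mon_span[t tB e].
  by exists t; rewrite // !pi_xymon.
- by move=> s t sB tB /=; rewrite !xexp_xymon !yexp_xymon; apply: mon_inj.
Qed.

End GraphMonomials.

Section Moves.
Variables (K : fieldType) (G : sgraph).
Implicit Types (a b alpha : G -> nat) (u v w z : G).
Local Notation qmon := (@qmon K G).
Local Notation qx := (@qx K G).
Local Notation qy := (@qy K G).

Definition incr u a : G -> nat := fun w => ((w == u) + a w)%N.
Definition decr u a : G -> nat := fun w => (a w - (w == u))%N.

Lemma incrK u a : (0 < a u)%N -> incr u (decr u a) = a.
Proof.
move=> a_u; apply/funext => w; rewrite /incr /decr.
by case: eqP => [->|_]; rewrite ?subnKC // subn0.
Qed.

Lemma sum_incr u a : (\sum_v incr u a v = (\sum_v a v).+1)%N.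
Proof.
rewrite big_split /= (bigD1 u) //= eqxx big1 ?addn0 ?add1n // => v /negPf-> //.
Qed.

Lemma eq_of_sum_eq a b : (forall v, a v <= b v)%N ->
  (\sum_v a v = \sum_v b v)%N -> a = b.
Proof.
move=> le_ab sumE; apply/funext => v; apply/eqP; rewrite eqn_leq le_ab leqNgt.
apply/negP => lt_v; move: sumE; rewrite (bigD1 v) //= [RHS](bigD1 v) //=.
have := @leq_sum _ (index_enum G) (fun w => w != v) a b (fun w _ => le_ab w).
lia.
Qed.

Lemma qmon_incr_x u a b : qmon (incr u a) b = qx u * qmon a b.
Proof.
rewrite /qmon (bigD1 u) //= [X in _ = _ * X](bigD1 u) //= /incr eqxx add1n exprS !mulrA.
by congr (_ * _); apply: eq_bigr => v /negPf->.
Qed.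

Lemma qmon_incr_y u a b : qmon a (incr u b) = qy u * qmon a b.
Proof.
rewrite /qmon (bigD1 u) //= [X in _ = _ * X](bigD1 u) //= /incr eqxx add1n exprS.
rewrite !mulrA [_ * qy u]mulrC.
by congr (_ * _); apply: eq_bigr => v /negPf->.
Qed.

(* The Pluecker relation [x_z f_uv = x_u f_zv - x_v f_zu], and the same for
   [y_z], where [f] denotes the binomial of a pair of vertices.             *)
Lemma swap_common_neighbor z u v a b :
    adj z u -> adj z v -> (0 < a z + b z)%N ->
  qx u * qy v * qmon a b = qx v * qy u * qmon a b.
Proof.
move=> zu zv; rewrite addn_gt0 => /orP[/incrK<-|/incrK<-].
  rewrite qmon_incr_x !mulrA; congr (_ * _).
  rewrite -!mulrA ![qy _ * qx z]mulrC !(qx_qy_adj K zv) !(qx_qy_adj K zu).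
  by rewrite mulrCA.
rewrite qmon_incr_y !mulrA; congr (_ * _).
rewrite [LHS]mulrAC [RHS]mulrAC -(qx_qy_adj K zu) -(qx_qy_adj K zv).
by rewrite mulrAC.
Qed.

Lemma qmon_move u v a b : (0 < a u)%N -> (0 < b v)%N ->
    qx u * qy v * qmon (decr u a) (decr v b) =
    qx v * qy u * qmon (decr u a) (decr v b) ->
  qmon a b = qmon (incr v (decr u a)) (incr u (decr v b)).
Proof.
move=> a_u b_v; rewrite -2!mulrA -!qmon_incr_y -!qmon_incr_x !incrK //.
Qed.

Lemma incr_decrD u v a b w : (0 < a u)%N -> (0 < b v)%N ->
  (incr v (decr u a) w + incr u (decr v b) w = a w + b w)%N.
Proof.
rewrite /incr /decr => a_u b_v.
have [->|wu] := eqVneq w u; have [e|wv] := eqVneq _ v; rewrite ?e in a_u b_v *; lia.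
Qed.

(** When all swaps are allowed in multidegree [alpha], the y-exponents [b] can be carried to [b']
    one unit at a time, from a vertex where [b] is too large to one where it is too small. Equal
    totals guarantee that both exist together. *)
Lemma qmon_eq_of_swap alpha :
    (forall u v a b, u != v -> (forall w, incr u a w + incr v b w = alpha w)%N ->
       qx u * qy v * qmon a b = qx v * qy u * qmon a b) ->
  forall a b a' b', (forall w, a w + b w = alpha w)%N ->
    (forall w, a' w + b' w = alpha w)%N ->
    (\sum_v b v = \sum_v b' v)%N -> qmon a b = qmon a' b'.
Proof.
move=> swap a b a' b'.
(* The subtraction is truncated, so the measure adds up the deficits of [b] only; each swap lowers
   it by one. *)
have [d] := ubnP (\sum_v (b' v - b v)); elim: d a b => // d IHd a b lt_d abE a'b'E sumE.
have [[u lt_u]|/forallNP le_b] := EM (exists u, b u < b' u)%N; last first.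
  have bE : b = b'.
    by apply/esym/eq_of_sum_eq => // v; rewrite leqNgt; apply/negP/le_b.
  have -> : a = a' by apply/funext => v; have := abE v; have := a'b'E v; rewrite bE; lia.
  by rewrite bE.
have [w lt_w] : exists w, (b' w < b w)%N.
  apply: contrapT; rewrite -forallNP => ge_b; move: lt_u; rewrite (@eq_of_sum_eq b b') ?ltnn // => v.
  by rewrite leqNgt; apply/negP/ge_b.
have a_u : (0 < a u)%N by have := abE u; have := a'b'E u; lia.
have b_w : (0 < b w)%N by lia.
have uw : u != w by apply: contraTneq lt_u => ->; rewrite -leqNgt ltnW.
rewrite (qmon_move a_u b_w); last first.
  by apply: swap => // z; rewrite !incrK.
apply: IHd => //.
- rewrite -ltnS (leq_trans _ lt_d) // ltnS (bigD1 u) //= [X in (_ < X)%N](bigD1 u) //=.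
  rewrite -addSn leq_add //.
    by rewrite /incr /decr eqxx (negPf uw) subn0; lia.
  apply: leq_sum => z /negPf zu; rewrite /incr /decr zu; case: eqP => [->|_]; lia.
- by move=> z; rewrite incr_decrD.
- by rewrite sum_incr -sumE -(sum_incr w) incrK.
Qed.

End Moves.

(** * Monomials modulo the ideal of a fan *)

Section Staircase.
Variables (p : nat) (alpha : 'I_p -> nat).
Implicit Types b : 'I_p -> nat.

Definition psum b (n : nat) : nat := \sum_(l < p | (l < n)%N) b l.

Lemma psumS b (i : 'I_p) : psum b i.+1 = (psum b i + b i)%N.
Proof.
rewrite /psum (bigD1 i) //= addnC; congr (_ + _)%N; apply: eq_bigl => l.
by rewrite ltnS -val_eqE /= ltn_neqAle andbC.
Qed.

Lemma psum_all b : psum b p = (\sum_l b l)%N.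
Proof. by apply: eq_bigl => l; rewrite ltn_ord. Qed.

(** With alpha = a + b, the first alternative means that x_i is absent. The condition thus excludes
    the factors x_i y_(i+1), in terms of the y-exponents alone. *)
Definition staircase b : Prop :=
  forall i j : 'I_p, i.+1 = j -> b i = alpha i \/ b j = 0%N.

(* Where [b'] overtakes [b], the staircase condition forces [b = 0] up to the
   next gap, so that the partial sums cannot agree there.                   *)
Lemma staircase_psum_le b b' n :
    staircase b -> (forall i : 'I_p, alpha i = 0%N -> psum b i = psum b' i) ->
    (\sum_i b i = \sum_i b' i)%N -> (n <= p)%N ->
    (forall i : 'I_p, i = n :> nat -> b i = 0%N) ->
  (psum b' n <= psum b n)%N.
Proof.
move=> stair gap sumE; have [d] := ubnP (p - n)%N.
elim: d n => // d IHd n lt_d le_np b0; rewrite leqNgt; apply/negP => lt_n.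
have [lt_np|ge_np] := ltnP n p; last first.
  have e : n = p by apply/eqP; rewrite eqn_leq le_np.
  by rewrite e !psum_all sumE ltnn in lt_n.
pose i := Ordinal lt_np; have bi0 : b i = 0%N by exact: b0.
have [a0|a_i] := eqVneq (alpha i) 0%N.
  by move: lt_n; rewrite (gap i a0) ltnn.
have := IHd n.+1; rewrite (psumS b i) (psumS b' i) bi0 addn0 => le_S.
suff : (psum b' i + b' i <= psum b i)%N.
  by rewrite leqNgt => /negP[]; rewrite (leq_trans lt_n) // leq_addr.
apply: le_S => //; first by lia.
move=> j jE; have [bia|//] := stair i j (esym jE).
by move: a_i; rewrite -bia bi0.
Qed.

(** Compare from left to right. If the partial sums agree before i and c i < c' i, then c i < alpha
    i, so c vanishes at i + 1. Then [staircase_psum_le] applies at i + 1 and contradicts the strict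
    inequality. Exchanging the roles gives equality. *)
Lemma staircase_inj b b' :
    (forall i, b i <= alpha i)%N -> (forall i, b' i <= alpha i)%N ->
    staircase b -> staircase b' ->
    (forall i : 'I_p, alpha i = 0%N -> psum b i = psum b' i) ->
    (\sum_i b i = \sum_i b' i)%N ->
  b = b'.
Proof.
move=> le_b le_b' stair stair' gap sumE; apply/funext.
suff step (c c' : 'I_p -> nat) (i : 'I_p) : (forall i, c' i <= alpha i)%N ->
    staircase c -> (forall i : 'I_p, alpha i = 0%N -> psum c i = psum c' i) ->
    (\sum_i c i = \sum_i c' i)%N -> psum c i = psum c' i -> (c' i <= c i)%N.
  suff eq_psum n : (n <= p)%N -> psum b n = psum b' n.
    move=> i; apply/eqP; rewrite eqn_leq !step //; first exact/eq_psum/ltnW.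
      by move=> j /gap.
    exact/esym/eq_psum/ltnW.
  elim: n => [_|n IHn lt_np]; first by rewrite /psum !big_pred0.
  have IH := IHn (ltnW lt_np).
  rewrite (psumS b (Ordinal lt_np)) (psumS b' (Ordinal lt_np)) /= IH; congr (_ + _)%N.
  apply/eqP; rewrite eqn_leq !step //.
  by move=> j /gap.
move=> le_c' stair_c gap_c sum_c eq_i; rewrite leqNgt; apply/negP => lt_i.
have : (psum c' i.+1 <= psum c i.+1)%N.
  apply: staircase_psum_le => // j jE.
  have [cia|//] := stair_c i j (esym jE).
  by move: lt_i; rewrite cia ltnNge le_c'.
by rewrite !psumS eq_i leq_add2l leqNgt lt_i.
Qed.

End Staircase.

Section FanMoves.
Variables (K : fieldType) (p q : nat).
Local Notation G := (fan_graph p q).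
Implicit Types (a b alpha : G -> nat).
Local Notation qmon := (@qmon K G).
Local Notation qx := (@qx K G).
Local Notation qy := (@qy K G).

Definition mixed alpha : bool :=
  [exists i : 'I_p, 0 < alpha (inl i)]%N && [exists j : 'I_q, 0 < alpha (inr j)]%N.

(** Every swap is available: vertices on opposite sides are adjacent, and two vertices on one side
    have a common neighbour in the support on the other side. *)
Lemma mixed_qmon_eq alpha a b a' b' : mixed alpha ->
    (forall w, a w + b w = alpha w)%N -> (forall w, a' w + b' w = alpha w)%N ->
    (\sum_v b v = \sum_v b' v)%N -> qmon a b = qmon a' b'.
Proof.
case/andP=> /existsP[i0 i0P] /existsP[j0 j0P].
move=> abE a'b'E; apply: qmon_eq_of_swap abE a'b'E => [[i|i] [j|j] c d _ cdE].
- apply: (@swap_common_neighbor K G (inr j0)) => //.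
  by move: j0P; rewrite -cdE.
- by rewrite (@qx_qy_adj K G (inl i) (inr j)).
- by rewrite (@qx_qy_adj K G (inr i) (inl j)).
- apply: (@swap_common_neighbor K G (inl i0)) => //.
  by move: i0P; rewrite -cdE.
Qed.

Definition path_std a b : bool :=
  [forall i : 'I_p, forall j : 'I_p,
     (i.+1 == j) ==> ((a (inl i) == 0) || (b (inl j) == 0))]%N.

(** Replacing x_i y_(i+1) by x_(i+1) y_i lowers the weight [f], the sum of the positions of the
    y-factors, by one, so the rewriting terminates. *)
Lemma path_std_exists a b : exists a' b',
  [/\ forall v, (a' v + b' v = a v + b v)%N, qmon a b = qmon a' b' & path_std a' b'].
Proof.
pose f b := (\sum_(i < p) i * b (inl i))%N.
have fS i c : f (@incr G (inl i) c) = (i + f c)%N.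
  rewrite /f (bigD1 i) //= [in RHS](bigD1 i) //= /incr eqxx mulnDr muln1 addnA.
  congr (_ + _)%N; apply: eq_bigr => l li.
  by rewrite -[inl l == inl i]/(l == i) (negPf li).
have [d] := ubnP (f b); elim: d a b => // d IHd a b lt_d.
have [std|] := boolP (path_std a b); first by exists a, b.
case/forallPn=> i /forallPn[j]; rewrite negb_imply negb_or -!lt0n.
case/and3P=> /eqP ij a_i b_j.
have adj_ij : @adj G (inl i) (inl j) by rewrite /= /path_adj ij eqxx.
have move_ij := @qmon_move K G _ _ _ _ a_i b_j.
have [|a' [b' [ab'E qE std]]] :=
    IHd (@incr G (inl j) (@decr G (inl i) a)) (@incr G (inl i) (@decr G (inl j) b)).
  by move: lt_d; rewrite -[b in f b](@incrK G _ _ b_j) !fS -[(j : nat)]ij addSn ltnS.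
exists a', b'; split=> // [v|].
  by rewrite ab'E incr_decrD.
by rewrite move_ij // (qx_qy_adj K adj_ij).
Qed.

(* If the support of a monomial meets both sides of the join, its class modulo
   the ideal is determined by its multidegree and its total degree in the y's.
   Otherwise the y-degree of each connected component of the support is also
   an invariant; it is recorded by the partial sums at the gaps of the path. *)
Definition fan_class a b : {ffun G -> nat} * nat * {ffun G -> nat} :=
  let alpha := fun v => (a v + b v)%N in
  ([ffun v => alpha v], \sum_v b v,
   [ffun v => if mixed alpha then 0 else
      match v with
      | inl i => if alpha v == 0 then psum (b \o inl) i else 0
      | inr _ => b v
      end])%N.

Lemma psum_incr_inl b (i : 'I_p) n :
  psum (@incr G (inl i) b \o inl) n = ((i < n) + psum (b \o inl) n)%N.
Proof.
rewrite /psum /= big_split /=; congr (_ + _)%N.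
have [lt_in|le_ni] := ltnP i n.
  rewrite (bigD1 i) //= eqxx big1 // => l /andP[_ /negPf li].
  by rewrite -[inl l == inl i]/(l == i) li.
rewrite big1 // => l lt_ln; rewrite -[inl l == inl i]/(l == i).
by case: eqP lt_ln => // ->; rewrite ltnNge le_ni.
Qed.

(** An edge between the two sides makes the multidegree mixed, where only totals are recorded. An
    edge of the path has both ends on the same side of any gap, so the partial sum there does not
    change. *)
Lemma fan_class_adj a b (u v : G) : adj u v ->
  fan_class (incr u a) (incr v b) = fan_class (incr v a) (incr u b).
Proof.
move=> uv; rewrite /fan_class /=.
have alphaE : (fun w => incr u a w + incr v b w)%N = (fun w => incr v a w + incr u b w)%N.
  by apply/funext => w; rewrite /incr; lia.
rewrite alphaE; congr (_, _, _).
  by rewrite (@sum_incr G v b) (@sum_incr G u b).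
apply/ffunP => w; rewrite !ffunE; case: ifP => // /negbT/negP nmixed.
case: u v uv alphaE nmixed => [i|i] [j|j] uv alphaE nmixed //=.
- case: w => [l|l] //=.
  have := congr1 (fun f => f (inl l)) alphaE; rewrite /= => ->.
  case: eqP => //; rewrite !psum_incr_inl /incr => alpha0; congr (_ + _)%N.
  have [li lj] : l != i /\ l != j.
    by split; apply/eqP => e; move: alpha0; rewrite e eqxx; lia.
  move: uv li lj; rewrite /= /path_adj -!val_eqE /=.
  by case/orP=> /eqP <-; lia.
- case: nmixed; apply/andP; split; apply/existsP; [exists i | exists j];
    by rewrite /incr eqxx; lia.
- case: nmixed; apply/andP; split; apply/existsP; [exists j | exists i];
    by rewrite /incr eqxx; lia.
Qed.

Lemma fan_class_eq a b a' b' : fan_class a b = fan_class a' b' ->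
  [/\ forall v, (a v + b v = a' v + b' v)%N, (\sum_v b v = \sum_v b' v)%N &
      ~~ mixed (fun v => a v + b v)%N ->
      (forall j, b (inr j) = b' (inr j)) /\
      (forall i, (a (inl i) + b (inl i) = 0)%N -> psum (b \o inl) i = psum (b' \o inl) i)].
Proof.
case=> /ffunP alphaE sumE /ffunP gE.
have abE v : (a v + b v = a' v + b' v)%N by have := alphaE v; rewrite !ffunE.
have abE' : (fun v => a v + b v)%N = (fun v => a' v + b' v)%N by apply/funext.
split=> // /negPf nmx; split=> [j|i ab0].
  by have := gE (inr j); rewrite !ffunE /= -abE' nmx.
by have := gE (inl i); rewrite !ffunE /= -abE' nmx -abE ab0.
Qed.

Lemma path_std_staircase alpha a b : (forall v, a v + b v = alpha v)%N -> path_std a b ->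
  staircase (alpha \o inl) (b \o inl).
Proof.
move=> abE /forallP std i j ij; have /forallP/(_ j) := std i.
rewrite ij eqxx => /orP[/eqP ai0|/eqP bj0]; [left | by right].
by rewrite /= -abE ai0.
Qed.

(** The class fixes the y-exponents at the isolated vertices, hence the total y-degree on the path;
    [staircase_inj] then determines the exponents there. *)
Lemma path_std_inj a b a' b' : fan_class a b = fan_class a' b' ->
    ~~ mixed (fun v => a v + b v)%N -> path_std a b -> path_std a' b' ->
  a = a' /\ b = b'.
Proof.
move=> /fan_class_eq[abE sumE clE] /clE[b_r b_l] std std'.
have b_inl : b \o inl = b' \o inl.
  apply: (@staircase_inj p (fun i => a (inl i) + b (inl i))%N) => //.
  - by move=> i; rewrite leq_addl.
  - by move=> i; rewrite abE leq_addl.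
  - exact: (@path_std_staircase (fun v => a v + b v)%N a b).
  - by apply: (@path_std_staircase (fun v => a v + b v)%N a' b') => // v; rewrite abE.
  move: sumE; rewrite big_sumType [RHS]big_sumType /=.
  by rewrite (eq_bigr _ (fun j _ => b_r j)) => /addIn.
have bE : b = b'.
  by apply/funext => -[i|j]; [exact: (congr1 (fun f => f i) b_inl) | exact: b_r].
by split=> //; apply/funext => v; have := abE v; rewrite bE => /addIn.
Qed.

(** Supplies a representative of the class with multidegree [alpha] and total y-degree [y]. *)
Lemma fill alpha y : (y <= \sum_v alpha v)%N ->
  exists b, (forall v, b v <= alpha v)%N /\ (\sum_v b v = y)%N.
Proof.
elim: y => [_|y IHy lt_y]; first by exists (fun=> 0%N); split=> //; rewrite big1.
have [b [le_b sum_b]] := IHy (ltnW lt_y).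
have [v lt_v] : exists v, (b v < alpha v)%N.
  apply: contrapT; rewrite -forallNP => ge_b; move: lt_y.
  rewrite -sum_b ltnNge leq_sum // => v _; rewrite leqNgt; exact/negP/ge_b.
exists (incr v b); split=> [w|]; last by rewrite sum_incr sum_b.
by rewrite /incr; case: eqP => [->|_] //; rewrite add0n.
Qed.

Section Basis.
Variable k : nat.

(** In degree [k] all exponents are at most [k], which makes the index type finite. The left summand
    holds exponent pairs (x, y) of standard monomials; the right one holds a multidegree with a
    total y-degree, for the mixed classes. *)
Definition std_index : finType :=
  ({ffun G -> 'I_k.+1 * 'I_k.+1} + {ffun G -> 'I_k.+1} * 'I_k.+1)%type.

Definition std_pred (t : std_index) : bool :=
  match t with
  | inl s => [&& (\sum_v ((s v).1 + (s v).2) == k)%N,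
                 ~~ mixed (fun v => (s v).1 + (s v).2)%N &
                 path_std (fun v => (s v).1) (fun v => (s v).2)]
  | inr (alpha, y) => (\sum_v (alpha v : nat) == k)%N && mixed (fun v => alpha v)
  end.

Lemma fan_basis : exists b : 'I_#|std_pred| -> {ideal_quot (binomial_edge_ideal K G)},
  is_basis (@graded_part K _ (binomial_edge_ideal K G) k) b.
Proof.
pose fills (z : (G -> nat) * nat) b :=
  (z.2 <= \sum_v z.1 v)%N -> (forall v, b v <= z.1 v)%N /\ (\sum_v b v = z.2)%N.
have [fl flP] : {fl & forall z, fills z (fl z)}.
  apply: choice => -[alpha y]; have [le_y|gt_y] := leqP y (\sum_v alpha v).
    by have [b bP] := fill le_y; exists b.
  (* Default for [y] too large, where [fills] is vacuous. *)
  by exists alpha => le_y; move: gt_y; rewrite ltnNge => /negP[].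
pose mon (t : std_index) : (G -> nat) * (G -> nat) :=
  match t with
  | inl s => (fun v => (s v).1 : nat, fun v => (s v).2 : nat)
  | inr (alpha, y) =>
      let b := fl (fun v => alpha v : nat, y : nat) in (fun v => alpha v - b v, b)%N
  end.
have flP' (alpha : {ffun G -> 'I_k.+1}) (y : 'I_k.+1) : (\sum_v (alpha v : nat) == k)%N ->
    (forall v, fl (fun v => alpha v : nat, y : nat) v <= alpha v)%N /\
    (\sum_v fl (fun v => alpha v : nat, y : nat) v = y)%N.
  by move/eqP=> sumE; apply: flP; rewrite /= sumE -ltnS.
have := @graph_basis K G k std_index std_pred mon _ fan_class.
move=> basis; eexists; apply: basis.
- by move=> a b u v; apply: fan_class_adj.
- case=> [s /andP[/eqP ] //|[alpha y] /andP[sumE _]] /=.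
  rewrite -[RHS](eqP sumE); apply: eq_bigr => v _; rewrite subnK //.
  by have [] := flP' alpha y sumE.
- move=> a b sumE.
  have le_k v : (a v + b v <= k)%N by rewrite -sumE (bigD1 v) //= leq_addr.
  have [mx|nmx] := boolP (mixed (fun v => a v + b v)%N).
    have le_yk : (\sum_v b v <= k)%N.
      by rewrite -sumE leq_sum // => v _; rewrite leq_addl.
    pose s := [ffun v : G => inord (a v + b v) : 'I_k.+1].
    have sE : (fun v => s v : nat) = (fun v => a v + b v)%N.
      by apply/funext => v; rewrite ffunE inordK // ltnS.
    have sumE' : (\sum_v (s v : nat) == k)%N.
      by rewrite -[X in _ == X]sumE; apply/eqP/eq_bigr => v _; exact: (congr1 (fun f => f v) sE).
    have [le_fl sum_fl] := flP' _ (inord (\sum_v b v)) sumE'.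
    exists (inr (s, inord (\sum_v b v))).
      by rewrite unfold_in /= sumE' sE mx.
    apply: (mixed_qmon_eq mx) => //= [w|].
      by rewrite subnK ?le_fl // -[RHS](congr1 (fun f => f w) sE).
    by rewrite sum_fl inordK.
  have [a' [b' [ab' qE std]]] := path_std_exists a b.
  pose s := [ffun v => (inord (a' v), inord (b' v)) : 'I_k.+1 * 'I_k.+1].
  have aE : (fun v => (s v).1 : nat) = a'.
    by apply/funext => v; rewrite ffunE inordK // ltnS (leq_trans _ (le_k v)) // -ab' leq_addr.
  have bE : (fun v => (s v).2 : nat) = b'.
    by apply/funext => v; rewrite ffunE inordK // ltnS (leq_trans _ (le_k v)) // -ab' leq_addl.
  have abE : (fun v => (s v).1 + (s v).2)%N = (fun v => a v + b v)%N.
    by apply/funext => v; rewrite -ab' -aE -bE.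
  exists (inl s); last by rewrite /= aE bE.
  rewrite unfold_in /= abE aE bE nmx std !andbT.
  by rewrite -[X in _ == X]sumE; apply/eqP/eq_bigr => v _; exact: (congr1 (fun f => f v) abE).
have monE (alpha : {ffun G -> 'I_k.+1}) (y : 'I_k.+1) : inr (alpha, y) \in std_pred ->
    (fun v => (mon (inr (alpha, y))).1 v + (mon (inr (alpha, y))).2 v)%N =
    (fun v => alpha v : nat).
  case/andP=> sumE _; apply/funext => v; rewrite subnK //.
  by have [] := flP' alpha y sumE.
(* The class determines the multidegree and hence whether it is mixed, so the two kinds of index
   never collide. *)
case=> [s|[alpha y]] [s'|[alpha' y']].
- case/and3P=> _ nmx std /and3P[_ _ std'] /path_std_inj[] // aE bE.
  congr (inl _); apply/ffunP => v.
  have /val_inj av := congr1 (fun f => f v) aE.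
  have /val_inj bv := congr1 (fun f => f v) bE.
  by rewrite [LHS]surjective_pairing [RHS]surjective_pairing av bv.
- move=> /and3P[_ nmx _] t'B /fan_class_eq[/funext abE _ _].
  case/negP: nmx; move: abE; rewrite (monE _ _ t'B) /= => ->.
  by case/andP: t'B.
- move=> tB /and3P[_ nmx _] /fan_class_eq[/funext abE _ _].
  case/negP: nmx; move: abE; rewrite (monE _ _ tB) /= => <-.
  by case/andP: tB.
- move=> tB t'B /fan_class_eq[/funext abE sumE _].
  move: abE sumE; rewrite (monE _ _ tB) (monE _ _ t'B) /= => abE.
  have [/andP[sa _] /andP[sa' _]] := (tB, t'B).
  have [_ ->] := flP' alpha y sa; have [_ ->] := flP' alpha' y' sa'.
  move=> /val_inj <-; congr (inr (_, _)); apply/ffunP => v.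
  exact/val_inj/(congr1 (fun f => f v) abE).
Qed.

End Basis.
End FanMoves.

(** * The Hilbert series *)

Lemma coef_prod_card (I J : finType) (k : nat) (f : I -> fps int)
    (dg : J -> nat) (P : I -> pred J) :
    (forall i j, (j <= k)%N ->
       fps_coef (f i) j = (\sum_(x | dg x == j) P i x)%:R) ->
  fps_coef (\prod_i f i) k =
    (\sum_(s : {ffun I -> J} | (\sum_i dg (s i) == k)%N) [forall i, P i (s i)])%:R.
Proof.
move=> fE; rewrite (@coef_prod_fps _ I J k f dg (fun i x => (P i x)%:R)) => [|i j le_jk].
  rewrite raddf_sum /=; apply: eq_bigr => s _.
  have [/forallP Ps|/forallPn[i nPi]] := boolP [forall i, P i (s i)].
    by rewrite big1 // => i _; rewrite Ps.
  by rewrite (bigD1 i) //= (negPf nPi) mul0r.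
by rewrite fE // raddf_sum.
Qed.

Lemma big_antidiagonal (k j : nat) (F : nat -> nat -> nat) : (j <= k)%N ->
  (\sum_(x : 'I_k.+1 * 'I_k.+1 | x.1 + x.2 == j) F x.1 x.2 =
   \sum_(i < j.+1) F i (j - i))%N.
Proof.
move=> le_jk.
rewrite (big_ord_widen k.+1 (fun i => F i (j - i)%N)) ?ltnS //.
rewrite -(pair_big_dep xpredT (fun a b : 'I_k.+1 => (a + b == j)%N)
  (fun a b : 'I_k.+1 => F a b)) /= [RHS]big_mkcond.
apply: eq_bigr => a _; case: ifP => [le_aj|gt_aj].
  have lt_k : (j - a < k.+1)%N by rewrite ltnS (leq_trans (leq_subr _ _)).
  rewrite (big_pred1 (Ordinal lt_k)) // => b /=.
  by rewrite -val_eqE /=; lia.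
by rewrite big_pred0 // => b; lia.
Qed.

Lemma coef_geom2 (k j : nat) : (j <= k)%N ->
  fps_coef (geom ^+ 2) j = (\sum_(x : 'I_k.+1 * 'I_k.+1 | (x.1 + x.2 == j)%N) 1)%:R.
Proof.
move=> le_jk; rewrite (@big_antidiagonal k j (fun _ _ => 1%N)) //.
rewrite fps_coefM raddf_sum /=; apply: eq_bigr => i _.
by rewrite !coef_geom mulr1.
Qed.

Lemma fps_coefXM (f : fps int) n :
  fps_coef ('t * f) n = if n is m.+1 then fps_coef f m else 0.
Proof.
rewrite fps_coefM big_ord_recl /= coefX mul0r add0r.
case: n => [|n]; first by rewrite big_ord0.
rewrite big_ord_recl big1 /= ?coefX ?mul1r ?addr0 ?subSS ?subn0 // => i _.
by rewrite coefX mul0r.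
Qed.

(** The Hilbert series of K[x,y]/(xy): one monomial in degree 0 and two in every positive degree. *)
Lemma coef_axes (k j : nat) : (j <= k)%N ->
  fps_coef ((1 + 't) * geom) j =
  (\sum_(x : 'I_k.+1 * 'I_k.+1 | x.1 + x.2 == j) ((x.1 == 0 :> nat) || (x.2 == 0 :> nat)))%N%:R.
Proof.
move=> le_jk.
rewrite (@big_antidiagonal k j (fun a b => (a == 0) || (b == 0))%N) //.
rewrite mulrDl mul1r fps_coefD coef_geom fps_coefXM.
case: j le_jk => [|j] _; first by rewrite big_ord1 addr0.
rewrite coef_geom big_ord_recl big_ord_recr big1 => [|i _] /=.
  by rewrite /bump /= add1n subnn.
by rewrite /bump /= add1n subSS subn_eq0 leqNgt ltn_ord.
Qed.

Lemma coef_origin (k j : nat) : (j <= k)%N ->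
  fps_coef (1%R : fps int) j =
  (\sum_(x : 'I_k.+1 * 'I_k.+1 | x.1 + x.2 == j) (x.1 + x.2 == 0))%N%:R :> int.
Proof.
move=> le_jk; rewrite (@big_antidiagonal k j (fun a b => (a + b == 0))%N) //.
case: j le_jk => [|j] _; first by rewrite big_ord1.
by rewrite big1 // => i _; rewrite subnKC // -ltnS.
Qed.

(** A vertex of [P] contributes a factor 1/(1 - t), any other vertex a factor 1. *)
Lemma coef_supp (k : nat) (I : finType) (P : pred I) :
  fps_coef (geom ^+ #|P|) k =
    (\sum_(s : {ffun I -> 'I_k.+1} | (\sum_i s i == k)%N)
       [forall i, P i || (s i == 0 :> nat)%N])%:R.
Proof.
rewrite -prodr_const big_mkcond.
rewrite (@coef_prod_card I 'I_k.+1 k _ (@nat_of_ord _)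
  (fun i x => P i || (x == 0 :> nat)%N)) // => i j le_jk.
have lt_jk : (j < k.+1)%N by [].
rewrite (big_pred1 (Ordinal lt_jk)) => [|x]; last by rewrite /= -val_eqE.
rewrite /= -topredE /=; case: (P i); first by rewrite coef_geom.
by rewrite fps_coef1.
Qed.

Section FanCount.
Variables (p q k : nat).
Hypothesis p_gt0 : (0 < p)%N.
Local Notation G := (fan_graph p q).

Definition left0 (alpha : G -> nat) : bool := [forall i : 'I_p, alpha (inl i) == 0%N].
Definition right0 (alpha : G -> nat) : bool := [forall j : 'I_q, alpha (inr j) == 0%N].

Lemma mixedE alpha : mixed alpha = ~~ left0 alpha && ~~ right0 alpha.
Proof.
by rewrite /mixed !negb_forall; congr (_ && _); apply: eq_existsb => i; rewrite lt0n.
Qed.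

Definition is_left (v : G) : bool := if v is inl _ then true else false.

Lemma card_is_left : #|is_left| = p.
Proof.
rewrite -sum1_card big_mkcond big_sumType /= sum1_card card_ord big1 ?addn0 //.
Qed.

Lemma card_is_right : #|predC is_left| = q.
Proof.
rewrite -sum1_card big_mkcond big_sumType /= big1 ?add0n // sum1_card card_ord //.
Qed.

Lemma forall_fan (P : pred G) :
  [forall v, P v] = [forall i : 'I_p, P (inl i)] && [forall j : 'I_q, P (inr j)].
Proof.
apply/forallP/andP => [Pv|[/forallP Pl /forallP Pr] [i|j]] //.
by split; apply/forallP => i; apply: Pv.
Qed.

Lemma forall_is_left alpha :
  [forall v, is_left v || (alpha v == 0%N)] = right0 alpha.
Proof. by rewrite forall_fan (_ : [forall i, _] = true) //; apply/forallP. Qed.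

Lemma forall_is_right alpha :
  [forall v, ~~ is_left v || (alpha v == 0%N)] = left0 alpha.
Proof. by rewrite forall_fan andbC (_ : [forall i, _] = true) //; apply/forallP. Qed.

Lemma forall_zero alpha : [forall v, alpha v == 0%N] = left0 alpha && right0 alpha.
Proof. by rewrite forall_fan. Qed.

(** Inclusion-exclusion on the two sides of the join; the last term corrects for the zero
    multidegree. The factor k + 1 counts the total y-degrees. *)
Lemma sum_mixed_fan :
  (\sum_(z : {ffun G -> 'I_k.+1} * 'I_k.+1 |
     (\sum_v (z.1 v : nat) == k) && mixed (fun v => z.1 v)) 1)%N%:R =
  k.+1%:R * (fps_coef (geom ^+ (p + q)) k - fps_coef (geom ^+ p) k
             - fps_coef (geom ^+ q) k + fps_coef (1%R : fps int) k) :> int.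
Proof.
have cT : #|@predT G| = (p + q)%N by rewrite card_sum !card_ord.
have := coef_supp k (@predT G); rewrite cT => ->.
have := coef_supp k is_left; rewrite card_is_left => ->.
have := coef_supp k (predC is_left); rewrite card_is_right => ->.
have := coef_supp k (@pred0 G); rewrite card0 expr0 => ->.
pose Q (s : {ffun G -> 'I_k.+1}) := (\sum_v (s v : nat) == k)%N && mixed (fun v => s v).
transitivity ((\sum_(z : {ffun G -> 'I_k.+1} * 'I_k.+1 | Q z.1 && xpredT z.2) 1)%N%:R : int).
  by congr (_%:R); apply: eq_bigl => z; rewrite andbT.
rewrite -(pair_big Q xpredT (fun _ _ => 1%N)) /=.
under eq_bigr do rewrite sum1_card card_ord.
rewrite /Q big_mkcondr !natr_sum -!sumrB -big_split mulr_sumr.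
apply: eq_bigr => s _.
rewrite (forall_is_left (fun v => s v)) (forall_is_right (fun v => s v)).
rewrite (forall_zero (fun v => s v)).
rewrite (_ : [forall i, _] = true); last by apply/forallP.
rewrite mixedE; case: (left0 _); case: (right0 _) => /=; ring.
Qed.

Local Notation pairs := ('I_k.+1 * 'I_k.+1)%type.
Local Notation degree x := (x.1 + x.2)%N.

Lemma count_left0 :
  fps_coef (geom ^+ (2 * q)) k =
  (\sum_(s : {ffun G -> pairs} | (\sum_v degree (s v) == k)%N)
     left0 (fun v => degree (s v)))%:R.
Proof.
transitivity (fps_coef (\prod_(v : G) (if is_left v then 1 else geom ^+ 2)) k).
  congr (fps_coef _ k); rewrite (bigID is_left) /= big1 ?mul1r => [|v -> //].
  have -> : geom ^+ (2 * q) = \prod_(v in predC is_left) geom ^+ 2.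
    by rewrite prodr_const card_is_right -exprM.
  by apply: eq_big => [v //|v]; rewrite -topredE /= => /negPf->.
rewrite (@coef_prod_card G pairs k _ (fun x => degree x)
  (fun v x => ~~ is_left v || (degree x == 0%N))) => [|v j le_jk].
  by congr (_%:R); apply: eq_bigr => s _; rewrite (forall_is_right (fun v => degree (s v))).
by case: (is_left v); [exact: coef_origin | exact: coef_geom2].
Qed.

Lemma count_zero :
  fps_coef (1%R : fps int) k =
  (\sum_(s : {ffun G -> pairs} | (\sum_v degree (s v) == k)%N)
     left0 (fun v => degree (s v)) && right0 (fun v => degree (s v)))%:R.
Proof.
transitivity (fps_coef (\prod_(v : G) (1 : fps int)) k); first by rewrite big1.
rewrite (@coef_prod_card G pairs k _ (fun x => degree x)
  (fun v x => degree x == 0%N)) => [|v j le_jk].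
  by congr (_%:R); apply: eq_bigr => s _; rewrite (forall_zero (fun v => degree (s v))).
exact: coef_origin.
Qed.

Definition next (v : G) : G := match v with inl i => inl (ordS i) | inr j => inr j end.
Definition prev (v : G) : G := match v with inl i => inl (ord_pred i) | inr j => inr j end.

Lemma nextK : cancel next prev.
Proof. by case=> //= i; rewrite ordSK. Qed.
Lemma prevK : cancel prev next.
Proof. by case=> //= i; rewrite ord_predK. Qed.

Definition shift_y (s : {ffun G -> pairs}) : {ffun G -> pairs} :=
  [ffun v => ((s v).1, (s (prev v)).2)].
Definition unshift_y (s : {ffun G -> pairs}) : {ffun G -> pairs} :=
  [ffun v => ((s v).1, (s (next v)).2)].

Lemma shift_yK : cancel shift_y unshift_y.
Proof. by move=> s; apply/ffunP => v; rewrite !ffunE nextK; case: (s v). Qed.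
Lemma unshift_yK : cancel unshift_y shift_y.
Proof. by move=> s; apply/ffunP => v; rewrite !ffunE prevK; case: (s v). Qed.

Lemma sum_shift_y s : (\sum_v degree (shift_y s v) = \sum_v degree (s v))%N.
Proof.
rewrite !big_split /=; congr (_ + _)%N.
  by apply: eq_bigr => v _; rewrite ffunE.
rewrite [RHS](reindex prev) /=; last exact: onW_bij (Bijective prevK nextK).
by apply: eq_bigr => v _; rewrite ffunE.
Qed.

(** Here the pair at i stands for the exponents of x_i and y_(i+1). The last vertex of the path
    carries the last x and the first y, without condition, so the path yields p - 1 factors (1 +
    t)/(1 - t) and one factor 1/(1 - t)^2. *)
Definition path_weight (v : G) (x : pairs) : bool :=
  match v with
  | inl i => (i.+1 < p)%N ==> (x.1 == 0%N :> nat) || (x.2 == 0%N :> nat)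
  | inr _ => degree x == 0%N
  end.

(* After shifting the [y]-exponents cyclically along the path, the condition
   [x_i y_(i+1) = 0] becomes a condition on a single vertex.                *)
Lemma path_std_shift s :
  right0 (fun v => degree (shift_y s v)) &&
    path_std (fun v => (shift_y s v).1) (fun v => (shift_y s v).2) =
  [forall v, path_weight v (s v)].
Proof.
rewrite forall_fan andbC; congr (_ && _).
  apply/forallP/forallP => [std i|std i].
    apply/implyP => lt_ip; have /forallP/(_ (Ordinal lt_ip)) := std i.
    rewrite eqxx !ffunE /= (_ : ord_pred _ = i) //.
    by apply: (canLR (@ordSK _)); apply/val_inj; rewrite /= modn_small.
  apply/forallP => j; apply/implyP => /eqP ij; have := std i.
  rewrite /= ij ltn_ord !ffunE /= (_ : ord_pred _ = i) //.
  by apply: (canLR (@ordSK _)); apply/val_inj; rewrite /= ij modn_small.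
by apply: eq_forallb => j; rewrite !ffunE.
Qed.

Lemma count_path_std :
  fps_coef ((1 + 't) ^+ (p - 1) * geom ^+ (p + 1)) k =
  (\sum_(s : {ffun G -> pairs} | (\sum_v degree (s v) == k)%N)
     (right0 (fun v => degree (s v)) &&
      path_std (fun v => (s v).1) (fun v => (s v).2)))%:R.
Proof.
transitivity (fps_coef (\prod_(v : G)
    match v with
    | inl i => if (i.+1 < p)%N then (1 + 't) * geom else geom ^+ 2
    | inr _ => 1
    end) k).
  congr (fps_coef _ k); rewrite big_sumType /= [X in _ = _ * X]big1 // mulr1.
  case: p p_gt0 => // p' _; rewrite big_ord_recr /= ltnn.
  rewrite (eq_bigr (fun=> (1 + 't) * geom)) => [|i _]; last by rewrite ltnS ltn_ord.
  by rewrite prodr_const card_ord subn1 exprMn -mulrA -exprD addn2 addn1.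
rewrite (@coef_prod_card G pairs k _ (fun x => degree x) path_weight) => [|v j le_jk].
  congr (_%:R); rewrite [RHS](reindex shift_y) /=; last first.
    exact: onW_bij (Bijective shift_yK unshift_yK).
  by apply: eq_big => s; rewrite ?sum_shift_y // path_std_shift.
case: v => [i|i] /=; last exact: coef_origin.
by case: ifP => _; [exact: coef_axes | exact: coef_geom2].
Qed.

(** A multidegree that is not mixed vanishes on one of the sides; if it vanishes on the path, every
    monomial is standard. The zero multidegree lies in both families. *)
Lemma card_std_pred :
  #|@std_pred p q k|%:R =
  fps_coef ((1 + 't) ^+ (p - 1) * geom ^+ (p + 1)) k + fps_coef (geom ^+ (2 * q)) k +
  k.+1%:R * (fps_coef (geom ^+ (p + q)) k - fps_coef (geom ^+ p) k
             - fps_coef (geom ^+ q) k) :> int.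
Proof.
(* The correction for the zero multidegree in the mixed count cancels the overlap in the other
   one. *)
have k1 : k.+1%:R * fps_coef (1%R : fps int) k = fps_coef (1%R : fps int) k.
  by rewrite fps_coef1; case: k => [|k']; rewrite ?mul1r ?mulr0.
rewrite -sum1_card big_sumType natrD.
have -> : (\sum_(i | inr i \in @std_pred p q k) 1 =
   \sum_(z : {ffun G -> 'I_k.+1} * 'I_k.+1 |
     (\sum_v (z.1 v : nat) == k) && mixed (fun v => z.1 v)) 1)%N.
  by apply: eq_bigl => -[alpha y].
rewrite sum_mixed_fan mulrDr k1 addrCA addrC; congr (_ + _).
have -> : (\sum_(i | inl i \in @std_pred p q k) 1 =
  \sum_(s : {ffun G -> pairs} | \sum_v degree (s v) == k)
     (~~ mixed (fun v => degree (s v)) &&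
      path_std (fun v => (s v).1) (fun v => (s v).2)))%N.
  pose C (s : {ffun G -> pairs}) := ~~ mixed (fun v => degree (s v)) &&
    path_std (fun v => (s v).1) (fun v => (s v).2).
  rewrite [RHS](eq_bigr (fun s => if C s then 1%N else 0%N)) => [|s _].
    by rewrite -big_mkcondr; apply: eq_bigl.
  by rewrite -/(C s); case: (C s).
rewrite count_path_std count_left0 count_zero -!natrD -!big_split; congr (_%:R).
apply: eq_bigr => s _; rewrite mixedE negb_and !negbK.
have [l0|_] := boolP (left0 _); last by rewrite /= !addn0.
suff -> : path_std (fun v => (s v).1) (fun v => (s v).2) by rewrite /= !andbT addnC.
apply/forallP => i; apply/forallP => j; apply/implyP => _.
by move/forallP/(_ i): l0; rewrite addn_eq0 => /andP[->].
Qed.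

End FanCount.

Lemma fan_hilbert_series (p q : nat) : (0 < p)%N ->
  FPS (fun k => #|@std_pred p q k|%:R) =
  (1 + 't) ^+ (p - 1) * geom ^+ (p + 1) + geom ^+ (2 * q)
  + ((p%:R + q%:R - 1) * 't + 1) * geom ^+ (p + q + 1)
  - ((p%:R - 1) * 't + 1) * geom ^+ (p + 1)
  - ((q%:R - 1) * 't + 1) * geom ^+ (q + 1).
Proof.
move=> p_gt0; rewrite -natrD -!succ_weighted_geomX; apply: fpsP => k.
rewrite /= card_std_pred //= -!addrA; congr (_ + (_ + _)).
by rewrite !mulrDr !mulrN addrA.
Qed.

(** * Chains of primes *)

Section PrimeChains.
Variables (K : fieldType) (n : nat) (I : idealr {mpoly K[n]}).
Local Notation S := {mpoly K[n]}.
Local Notation A := {ideal_quot I}.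
Local Notation pi := (\pi_A%qT : S -> A).

Lemma mpoly_rmorphism_ext (R : comNzRingType) (phi psi : {rmorphism S -> R}) :
    (forall c, phi c%:MP = psi c%:MP) -> (forall i, phi 'X_i = psi 'X_i) ->
  phi =1 psi.
Proof.
move=> eqC eqX f; rewrite (mpolyE f) !rmorph_sum; apply: eq_bigr => m _.
rewrite -mul_mpolyC !rmorphM /= eqC mpolyXE_id !rmorph_prod; congr (_ * _).
by apply: eq_bigr => i _; rewrite !rmorphXn /= eqX.
Qed.

Section Kernel.
Variables (D : idomainType) (phi : {rmorphism S -> D}).
Hypothesis phi_I : forall f, f \in I -> phi f = 0.

(** The kernel of the map induced by [phi] on S/I, read on chosen representatives; [mem_quot_kernel]
    gives independence of the choice. *)
Definition quot_kernel : {pred A} := fun u => phi (repr u) == 0.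

Lemma mem_quot_kernel f : (pi f \in quot_kernel) = (phi f == 0).
Proof.
rewrite unfold_in /quot_kernel; congr (_ == _); apply/eqP; rewrite -subr_eq0 -rmorphB.
by apply/eqP/phi_I; rewrite -quot_pi_eq0 rmorphB /= reprK subrr.
Qed.

Lemma quot_kernel_prime : prime_ideal quot_kernel.
Proof.
split; first split.
- by rewrite -(rmorph0 pi) mem_quot_kernel rmorph0.
- by rewrite -(rmorph1 pi) mem_quot_kernel rmorph1 oner_eq0.
- move=> a u v; rewrite -(reprK a) -(reprK u) -(reprK v) -rmorphM -rmorphD.
  rewrite !mem_quot_kernel rmorphD rmorphM => /eqP-> /eqP->.
  by rewrite mulr0 addr0.
move=> u v; rewrite -(reprK u) -(reprK v) -rmorphM !mem_quot_kernel rmorphM.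
by rewrite mulf_eq0.
Qed.

End Kernel.

Lemma prime_chain_of_steps m (P : nat -> {pred A}) :
    (forall i, prime_ideal (P i)) -> (forall i, {subset P i <= P i.+1}) ->
    (forall i, (i < m)%N -> ~ {subset P i.+1 <= P i}) ->
  has_prime_chain A m.
Proof.
move=> primeP subP properP; exists (fun i => P i); split=> // i j lt_ij.
have sub_le k l : (k <= l)%N -> {subset P k <= P l}.
  move=> /subnKC<-; elim: (l - k)%N => [|d IHd] u; first by rewrite addn0.
  by move=> /IHd; rewrite addnS; apply: subP.
split=> [|sub_ji]; first exact/sub_le/ltnW.
have lt_im : (i < m)%N by rewrite (leq_trans lt_ij) // -ltnS.
by apply: (properP i lt_im) => u /(sub_le _ _ lt_ij)/sub_ji.
Qed.

(** [r] gives the order in which the variables are sent to 0; stage [i] has removed those of rank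
    below [i]. *)
Definition kill (r : 'I_n -> nat) (i : nat) : S -> S :=
  mmap (@mpolyC n K) (fun z => if (r z < i)%N then 0 else 'X_z).

HB.instance Definition _ r i := GRing.RMorphism.on (kill r i).

Lemma kill_X r i z : kill r i 'X_z = if (r z < i)%N then 0 else 'X_z.
Proof. by rewrite /kill mmapX mmap1U. Qed.

Lemma kill_C r i c : kill r i c%:MP = c%:MP.
Proof. by rewrite /kill mmapC. Qed.

(** The primes are the kernels of [kill r i \o theta], which takes values in a domain. They increase
    because stage i + 1 factors through stage i, and the given elements make the inclusions
    strict. *)
Lemma prime_chain_of_kill m (theta : {rmorphism S -> S}) (r : 'I_n -> nat) :
    (forall f, f \in I -> theta f = 0) ->
    (forall i, (i < m)%N -> exists2 f,
       kill r i (theta f) != 0 & kill r i.+1 (theta f) = 0) ->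
  has_prime_chain A m.
Proof.
move=> theta_I step.
have phi_I i f : f \in I -> (kill r i \o theta) f = 0.
  by move=> /theta_I /= ->; rewrite rmorph0.
have [P primeP memP] : exists2 P : nat -> {pred A}, forall i, prime_ideal (P i) &
    forall i f, (pi f \in P i) = (kill r i (theta f) == 0).
  exists (fun i => quot_kernel (kill r i \o theta)) => i.
    exact: quot_kernel_prime (phi_I i).
  exact: (mem_quot_kernel (phi_I i)).
apply: (@prime_chain_of_steps m P) => [i|i u|i lt_im sub].
- exact: primeP.
- have killK : kill r i.+1 \o kill r i =1 kill r i.+1.
    apply: mpoly_rmorphism_ext => [c|z] /=; first by rewrite !kill_C.
    rewrite !kill_X; case: ifP => [lt_ri|_]; last by rewrite kill_X.
    by rewrite rmorph0 ltnS ltnW.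
  rewrite -(reprK u) (memP i) (memP i.+1) => /eqP kill0.
  by rewrite -killK /= kill0 rmorph0.
have [f f_i f_Si] := step i lt_im.
by have := sub (pi f); rewrite (memP i) (memP i.+1) f_Si eqxx (negPf f_i) => /(_ isT).
Qed.

End PrimeChains.

Section GraphChains.
Variables (K : fieldType) (G : sgraph).
Local Notation N := (#|G| + #|G|)%N.
Local Notation S := {mpoly K[N]}.
Local Notation J := (binomial_edge_ideal K G).

Definition on_vars (T : Type) (fx fy : G -> T) (z : 'I_N) : T :=
  match split z with inl j => fx (enum_val j) | inr j => fy (enum_val j) end.

Lemma on_vars_x T (fx fy : G -> T) v : on_vars fx fy (lshift _ (enum_rank v)) = fx v.
Proof. by rewrite /on_vars (unsplitK (inl _ : 'I_#|G| + 'I_#|G|)) enum_rankK. Qed.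

Lemma on_vars_y T (fx fy : G -> T) v : on_vars fx fy (rshift _ (enum_rank v)) = fy v.
Proof. by rewrite /on_vars (unsplitK (inr _ : 'I_#|G| + 'I_#|G|)) enum_rankK. Qed.

Definition subst (fx fy : G -> S) : S -> S := mmap (@mpolyC N K) (on_vars fx fy).
HB.instance Definition _ fx fy := GRing.RMorphism.on (subst fx fy).

Lemma subst_x fx fy (v : G) : subst fx fy (xvar K v) = fx v.
Proof. by rewrite /subst /xvar mmapX mmap1U on_vars_x. Qed.

Lemma subst_y fx fy (v : G) : subst fx fy (yvar K v) = fy v.
Proof. by rewrite /subst /yvar mmapX mmap1U on_vars_y. Qed.

Lemma edge_ideal_subst fx fy :
    (forall u v : G, adj u v -> fx u * fy v = fx v * fy u) ->
  forall f, f \in J -> subst fx fy f = 0.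
Proof.
move=> fxy f /asboolP[m [a [g [gE ->]]]]; rewrite rmorph_sum big1 // => i _.
have [u [v [uv _ ->]]] := gE i.
by rewrite rmorphM rmorphB !rmorphM /= !subst_x !subst_y fxy // subrr mulr0.
Qed.

Lemma prime_chain_of_subst m (fx fy : G -> S) (r : 'I_N -> nat) :
    (forall u v : G, adj u v -> fx u * fy v = fx v * fy u) ->
    (forall i, (i < m)%N -> exists v g,
       [/\ g = fx v \/ g = fy v, kill r i g != 0 & kill r i.+1 g = 0]) ->
  has_prime_chain {ideal_quot J} m.
Proof.
move=> fxy step; apply: (@prime_chain_of_kill K N J m (subst fx fy) r).
  exact: edge_ideal_subst.
move=> i /step[v [_ [[->|->] g_i g_Si]]].
  by exists (xvar K v); rewrite /= subst_x.
by exists (yvar K v); rewrite /= subst_y.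
Qed.

Lemma kill_x rx ry i (v : G) :
  kill (on_vars rx ry) i (xvar K v) = if (rx v < i)%N then 0 else xvar K v.
Proof. by rewrite /xvar kill_X on_vars_x. Qed.

Lemma kill_y rx ry i (v : G) :
  kill (on_vars rx ry) i (yvar K v) = if (ry v < i)%N then 0 else yvar K v.
Proof. by rewrite /yvar kill_X on_vars_y. Qed.

Lemma xvar_neq0 (v : G) : xvar K v != 0.
Proof. by rewrite -msize_poly_eq0 msizeX. Qed.

Lemma yvar_neq0 (v : G) : yvar K v != 0.
Proof. by rewrite -msize_poly_eq0 msizeX. Qed.

(* The substitution x_v := a_v, y_v := t a_v, with t realised as y_w; then the
   a_v are sent to 0 one after the other, except that t goes before a_w.    *)
Lemma rank_one_chain : (0 < #|G|)%N -> has_prime_chain {ideal_quot J} #|G|.+1.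
Proof.
move=> G_gt0; have lt_w : (#|G|.-1 < #|G|)%N by rewrite prednK.
pose w : G := enum_val (Ordinal lt_w).
have rank_w : enum_rank w = #|G|.-1 :> nat by rewrite enum_valK.
pose rx (v : G) : nat := if (enum_rank v < #|G|.-1)%N then (enum_rank v : nat) else #|G|.
pose fx (v : G) := xvar K v; pose fy (v : G) := yvar K w * xvar K v.
apply: (@prime_chain_of_subst _ fx fy (on_vars rx (fun=> #|G|.-1))) => [u v _|i].
  by rewrite /fx /fy mulrCA [RHS]mulrCA [xvar K u * _]mulrC.
rewrite ltnS leq_eqVlt => /orP[/eqP->|].
  have rw : rx w = #|G| by rewrite /rx rank_w ltnn.
  by exists w, (fx w); split; [left | |]; rewrite // kill_x rw ?ltnn ?xvar_neq0 ?ltnSn.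
rewrite -{1}(prednK G_gt0) ltnS leq_eqVlt => /orP[/eqP->|lt_i].
  exists w, (fy w); split; [by right | |]; rewrite rmorphM /= kill_x kill_y /rx rank_w !ltnn.
    by rewrite ltnNge leq_pred mulf_neq0 ?xvar_neq0 ?yvar_neq0.
  by rewrite ltnSn mul0r.
have lt_iG : (i < #|G|)%N by rewrite (leq_trans lt_i) ?leq_pred.
pose v : G := enum_val (Ordinal lt_iG).
have rv : rx v = i by rewrite /rx enum_valK /= lt_i.
by exists v, (fx v); split; [left | |]; rewrite // kill_x rv ?ltnn ?xvar_neq0 ?ltnSn.
Qed.

End GraphChains.

Section FanChains.
Variables (K : fieldType) (p q : nat).
Local Notation G := (fan_graph p q).
Local Notation J := (binomial_edge_ideal K G).

Lemma fan_chain_join : (0 < p + q)%N -> has_prime_chain {ideal_quot J} (p + q + 1).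
Proof.
have cG : #|G| = (p + q)%N by rewrite card_sum !card_ord.
have -> : (p + q + 1 = #|G|.+1)%N by rewrite cG addn1.
by move=> pq_gt0; apply: rank_one_chain; rewrite cG.
Qed.

(** Every edge meets the path, so sending the path variables to 0 annihilates the ideal. The 2q
    remaining variables are then removed one at a time, the x before the y. *)
Lemma fan_chain_right : has_prime_chain {ideal_quot J} (2 * q).
Proof.
pose fx (v : G) := if is_left v then 0 else xvar K v.
pose fy (v : G) := if is_left v then 0 else yvar K v.
pose rx (v : G) : nat := if v is inr j then j : nat else 0%N.
pose ry (v : G) : nat := if v is inr j then (q + j)%N else 0%N.
have fx0 i : fx (inl i) = 0 by [].
have fy0 i : fy (inl i) = 0 by [].
apply: (@prime_chain_of_subst K G _ fx fy (on_vars rx ry)) => [[i|i] [j|j] //|i lt_i].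
- by rewrite (fx0 i) (fy0 i) mul0r mulr0.
- by rewrite (fx0 j) (fy0 j) mul0r mulr0.
have [lt_iq|le_qi] := ltnP i q.
  pose v : G := inr (Ordinal lt_iq); have rv : rx v = i by [].
  by exists v, (fx v); split; [left | |]; rewrite // kill_x rv ?ltnn ?xvar_neq0 ?ltnSn.
have lt_iq : (i - q < q)%N by lia.
pose v : G := inr (Ordinal lt_iq); have rv : ry v = i by rewrite /= subnKC.
by exists v, (fy v); split; [right | |]; rewrite // kill_y rv ?ltnn ?yvar_neq0 ?ltnSn.
Qed.

End FanChains.

(** * Growth of the coefficients of a rational series *)

Section RationalSeries.
Import Order.TTheory Num.Theory.

Lemma leq_expn2r m1 m2 d : (m1 <= m2)%N -> (m1 ^ d <= m2 ^ d)%N.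
Proof. by case: d => // d; rewrite leq_exp2r. Qed.

Lemma coef_geomS d k : fps_coef (geom ^+ d.+1) k = \sum_(i < k.+1) fps_coef (geom ^+ d) i.
Proof.
by rewrite exprSr fps_coefM; apply: eq_bigr => i _; rewrite coef_geom mulr1.
Qed.

Lemma coef_geomX_bound d k : 0 <= fps_coef (geom ^+ d.+1) k <= (k.+1 ^ d)%N%:R.
Proof.
elim: d k => [|d IHd] k; first by rewrite expr1 coef_geom.
rewrite coef_geomS; apply/andP; split.
  by apply: sumr_ge0 => i _; case/andP: (IHd i).
have -> : (k.+1 ^ d.+1)%N%:R = \sum_(i < k.+1) (k.+1 ^ d)%N%:R :> int.
  by rewrite sumr_const card_ord expnS mulnC natrM mulr_natr.
apply: ler_sum => i _; case/andP: (IHd i) => _ /le_trans->//.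
by rewrite ler_nat leq_expn2r.
Qed.

(** Partial sums are the coefficients of Q/(1 - t)^(d + 1), and those of 1/(1 - t)^(d + 1) are at
    most (k + 1)^d; hence [C] is the sum of the absolute values of the coefficients of [Q]. *)
Lemma partial_sum_le (D : nat -> nat) (Q : {poly int}) d :
    FPS (fun k => (D k)%:R) = fps_poly Q * geom ^+ d ->
  exists C, forall k, (\sum_(j < k.+1) D j <= C * k.+1 ^ d)%N.
Proof.
move=> DE; exists (\sum_(i < size Q) absz (Q`_i)%R)%N => k.
have sumE : (\sum_(j < k.+1) D j)%N%:R = fps_coef (fps_poly Q * geom ^+ d.+1) k :> int.
  rewrite exprSr mulrA -DE fps_coefM natr_sum; apply: eq_bigr => j _.
  by rewrite coef_geom mulr1.
have le_sum : (\sum_(i < k.+1) absz (Q`_i)%R <= \sum_(i < size Q) absz (Q`_i)%R)%N.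
  have le_k := leq_maxl k.+1 (size Q); have le_Q := leq_maxr k.+1 (size Q).
  rewrite (big_ord_widen _ (fun i => absz (Q`_i)%R) le_k).
  rewrite (big_ord_widen _ (fun i => absz (Q`_i)%R) le_Q).
  rewrite big_mkcond [X in (_ <= X)%N]big_mkcond; apply: leq_sum => i _.
  have [_|le_i] := ltnP i (size Q); first by case: ifP.
  by rewrite nth_default //; case: ifP.
apply: leq_trans (leq_mul le_sum (leqnn _)).
rewrite -(ler_nat int) sumE fps_coefM natrM natr_sum mulr_suml; apply: ler_sum => i _.
have /andP[c_ge0 c_le] := coef_geomX_bound d (k - i).
rewrite natz abszE; apply: (@le_trans _ _ (`|Q`_i| * fps_coef (geom ^+ d.+1) (k - i))).
  by rewrite ler_wpM2r // ler_norm.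
rewrite ler_wpM2l // (le_trans c_le) // ler_nat.
by rewrite leq_expn2r // ltnS leq_subr.
Qed.

End RationalSeries.

(** * Hilbert series, dimension and multiplicity of the fan ring *)

Section FanRing.
Variables (K : fieldType) (p q : nat).
Hypotheses (p_gt0 : (0 < p)%N) (q_gt0 : (0 < q)%N).
Local Notation G := (fan_graph p q).
Local Notation J := (binomial_edge_ideal K G).

Lemma Hilb_fan : Hilb J = FPS (fun k => #|@std_pred p q k|%:R).
Proof.
apply: fpsP => k /=; have [b b_basis] := fan_basis K p q k.
by rewrite (subspace_dimE b_basis).
Qed.

Local Notation d := (maxn (2 * q) (p + q + 1)).

(** The numerator over the common denominator (1 - t)^d, where d is the Krull dimension. *)
Definition fan_numerator : {poly int} :=
  (1 + 'X) ^+ (p - 1) * (1 - 'X) ^+ (d - (p + 1)) + (1 - 'X) ^+ (d - 2 * q)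
  + ((p%:R + q%:R - 1) * 'X + 1) * (1 - 'X) ^+ (d - (p + q + 1))
  - ((p%:R - 1) * 'X + 1) * (1 - 'X) ^+ (d - (p + 1))
  - ((q%:R - 1) * 'X + 1) * (1 - 'X) ^+ (d - (q + 1)).

Lemma geomX_numerator e : (e <= d)%N -> geom ^+ e = fps_poly ((1 - 'X) ^+ (d - e)) * geom ^+ d.
Proof.
move=> le_ed; rewrite -[in geom ^+ d](subnK le_ed) exprD mulrA rmorphXn /= -exprMn.
by rewrite rmorphB rmorph1 /= [(1 - 't) * _]mulrC mulVr_1Bt expr1n mul1r.
Qed.

Lemma Hilb_fan_numerator : Hilb J = fps_poly fan_numerator * geom ^+ d.
Proof.
rewrite Hilb_fan fan_hilbert_series //.
have le_d1 : (p + 1 <= d)%N by rewrite leq_max; apply/orP; right; lia.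
have le_d2 : (q + 1 <= d)%N by rewrite leq_max; apply/orP; right; lia.
rewrite (geomX_numerator le_d1) (geomX_numerator le_d2).
rewrite (geomX_numerator (leq_maxl _ _ : 2 * q <= d)%N).
rewrite (geomX_numerator (leq_maxr _ _ : p + q + 1 <= d)%N).
have lin (c : {poly int}) : fps_poly ((c - 1) * 'X + 1) = (fps_poly c - 1) * 't + 1.
  by rewrite rmorphD rmorphM rmorphB rmorph1.
have bin : fps_poly ((1 + 'X) ^+ (p - 1)) = (1 + 't) ^+ (p - 1).
  by rewrite rmorphXn rmorphD rmorph1.
rewrite /fan_numerator 2!rmorphB 2!rmorphD 4!rmorphM /= bin !lin rmorphD !rmorph_nat.
by rewrite !(mulrBl (geom ^+ d)) !(mulrDl _ _ (geom ^+ d)) !mulrA.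
Qed.

(** At t = 1 only fractions with a pole of order d survive: 1/(1 - t)^(2q) gives 1 when p + 1 <= q,
    and the third fraction gives p + q when q <= p + 1. Both count when p + 1 = q. *)
Lemma fan_numerator1 : fan_numerator.[1] =
  if (p + 1 < q)%N then 1 else if (p + 1 == q)%N then (p + q + 1)%:R else (p + q)%:R.
Proof.
have e1 n : ((1 - 'X) ^+ n).[1] = (n == 0%N)%:R :> int.
  by rewrite horner_exp !hornerE subrr expr0n.
have h1 : (1 : {poly int}).[1] = 1 by rewrite hornerE.
rewrite /fan_numerator !(hornerD, hornerN, hornerM, hornerX, hornerMn) !e1 !h1 !mulr1.
have -> : (d - (p + 1) == 0)%N = false by lia.
have -> : (d - (q + 1) == 0)%N = false by lia.
rewrite !mulr0 !subr0 add0r !subrK -natrD.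
have -> : (d - 2 * q == 0)%N = (p + 1 <= q)%N by lia.
have -> : (d - (p + q + 1) == 0)%N = (q <= p + 1)%N by lia.
have [lt_pq|gt_pq|e_pq] := ltngtP (p + 1)%N q; rewrite ?mulr0 ?mulr1 ?addr0 ?add0r //.
by rewrite addrC [RHS]natrD.
Qed.

Lemma krull_dim_fan : has_krull_dim {ideal_quot J} d.
Proof.
split.
  rewrite /maxn; case: ifP => _; last exact: fan_chain_right.
  by apply: fan_chain_join; rewrite addn_gt0 p_gt0.
pose basis k := sval (cid (fan_basis K p q k)).
have b_basis k : is_basis (@graded_part K _ J k) (basis k).
  exact: (svalP (cid (fan_basis K p q k))).
have [C leC] := partial_sum_le (etrans (esym Hilb_fan) Hilb_fan_numerator).
move=> m; exact: krull_dim_le b_basis leC.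
Qed.

End FanRing.

Theorem corollary4p11 (K : fieldType) (p q : nat)
    (hp : (1 <= p)%N) (hq : (1 <= q)%N) :
  [/\ Hilb (binomial_edge_ideal K (fan_graph p q)) =
        (1 + 't) ^+ (p - 1) / (1 - 't) ^+ (p + 1)
        + 1 / (1 - 't) ^+ (2 * q)
        + ((p%:R + q%:R - 1) * 't + 1) / (1 - 't) ^+ (p + q + 1)
        - ((p%:R - 1) * 't + 1) / (1 - 't) ^+ (p + 1)
        - ((q%:R - 1) * 't + 1) / (1 - 't) ^+ (q + 1),
      has_krull_dim {ideal_quot (binomial_edge_ideal K (fan_graph p q))}
        (maxn (2 * q) (p + q + 1)) &
      has_multiplicity (binomial_edge_ideal K (fan_graph p q))
        (if (p + 1 < q)%N then 1
         else if (p + 1 == q)%N then (p + q + 1)%:R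
         else (p + q)%:R)].
Proof.
split; last 1 first.
- exists (maxn (2 * q) (p + q + 1)), (fan_numerator p q).
  split; [exact: krull_dim_fan | | by rewrite fan_numerator1].
  by rewrite -exprVn; exact: Hilb_fan_numerator.
- by rewrite Hilb_fan fan_hilbert_series // mul1r -!exprVn.
- exact: krull_dim_fan.
Qed.
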